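(* Let $n\ge 3$ be odd and let $X$ be the set of non-crossing partitions of $[n]=\{1,\dots,n\}$, with the action of the dihedral group $I_2(n)$ induced by its natural action on $[n]$. Then the triple $$\left(X,\ \frac{1}{\{n+1\}_{s,t}}\genfrac{\{}{\}}{0pt}{}{2n}{n}_{s,t},\ I_2(n)\right)$$ exhibits dihedral sieving.
   Context: A set partition of $[n]$ is non-crossing if its blocks do not cross when drawn on a disk whose boundary is labelled clockwise with $1,2,\dots,n$ (i.e. there are no $a<b<c<d$ with $a,c$ in one block and $b,d$ in a different block). $I_2(n)=\langle r,s \mid r^n=s^2=e,\ rs=sr^{-1}\rangle$ is the dihedral group of order $2n$. Its natural action on $[n]$ is the one on the vertices of a regular $n$-gon labelled cyclically by $1,\dots,n$ ($r$ acts as $i\mapsto i+1$ and $s$ as $i\mapsto -i$ modulo $n$). $\operatorname{Rep}(I_2(n))$ is the representation ring: the ring generated by isomorphism classes $[U]$ of finite-dimensional complex representations, with $[U\oplus V]=[U]+[V]$ and $[U\otimes V]=[U][V]$. For $n$ odd it is generated as a ring by $z_1$ and $\det$ (hence by $z_1$ and $-\det$). Here $z_1$ is the 2-dimensional representation sending $r$ to the rotation by $2\pi/n$ and $s$ to a reflection matrix, and $\det$ is the 1-dimensional representation with $\det(r)=1$, $\det(s)=-1$. Dihedral sieving: for $n$ odd, a finite $I_2(n)$-set $X$ and a polynomial $P(s,t)\in\mathbb{Z}[s,t]$, the triple $(X,P(s,t),I_2(n))$ exhibits dihedral sieving if $\mathbb{C}[X]=P(z_1,-\det)$ in $\operatorname{Rep}(I_2(n))$,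 where $\mathbb{C}[X]$ is the permutation representation. (The polynomial variable $s$ is unrelated to the group element $s$.) Generalized Fibonacci polynomials: $\{0\}_{s,t}=0$, $\{1\}_{s,t}=1$, $\{m+2\}_{s,t}=s\{m+1\}_{s,t}+t\{m\}_{s,t}$. Put $\{m\}!_{s,t}=\{m\}_{s,t}\{m-1\}_{s,t}\cdots\{1\}_{s,t}$ (with $\{0\}!_{s,t}=1$). The Fibonomial coefficient is $\genfrac{\{}{\}}{0pt}{}{m}{k}_{s,t}=\dfrac{\{m\}!_{s,t}}{\{k\}!_{s,t}\{m-k\}!_{s,t}}$. Known: $\genfrac{\{}{\}}{0pt}{}{m}{k}_{s,t}$ and $\frac{1}{\{n+1\}_{s,t}}\genfrac{\{}{\}}{0pt}{}{2n}{n}_{s,t}$ are polynomials in $s,t$ with integer coefficients. *)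

(* Defs.v *)
From mathcomp Require Import zify ring.
From HB Require Import structures.
From mathcomp Require Import all_boot all_order all_fingroup all_algebra.
From mathcomp Require Import mxrepresentation character ring_quotient complex.
From mathcomp Require Import generic_quotient boolp reals trigo.
From mathcomp Require Import finmap monalg.

Set Implicit Arguments.
Unset Strict Implicit.
Unset Printing Implicit Defensive.

Import Order.TTheory GRing.Theory Num.Theory.
Local Open Scope ring_scope.

Local Open Scope quotient_scope.

Section RepresentationChoice.
Variables (F : fieldType) (gT : finGroupType) (G : {group gT}).
HB.instance Definition _ := gen_eqMixin (representation F G).
HB.instance Definition _ := gen_choiceMixin (representation F G).
End RepresentationChoice.

(* Rep(G) is the commutative ring presented by one generator [U] per
   finite-dimensional representation U of G over F, with the relations
   [U] = [V] for U isomorphic to V, [U (+) V] = [U] + [V],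
   [U (x) V] = [U] [V] and [trivial] = 1.  It is the quotient of the free
   commutative ring on the generators by the ideal of the relations. *)
Definition free_rep_ring (F : fieldType) (gT : finGroupType) (G : {group gT}) :=
  {malg int[{cmonom (representation F G)}]}.

(* Locked: comparing two generators by conversion diverges in practice. *)
HB.lock Definition rep_gen (F : fieldType) (gT : finGroupType) (G : {group gT})
  (U : representation F G) : free_rep_ring F G := << ucm U >>.

Section RepresentationRing.

Variables (F : fieldType) (gT : finGroupType) (G : {group gT}).
Local Notation repr := (representation F G).
Local Notation freeR := (free_rep_ring F G).

Fact triv_mx_repr : mx_repr G (fun _ : gT => 1%:M : 'M[F]_1).
Proof. by split=> // g h _ _; rewrite mul1mx. Qed.

Definition triv_repr : repr := Representation (MxRepresentation triv_mx_repr).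

Inductive rep_relation : freeR -> Prop :=
  | rel_iso (U V : repr) of mx_rsim U V : rep_relation (rep_gen U - rep_gen V)
  | rel_dsum (U V : repr) :
      rep_relation (rep_gen (dadd_grepr U V) - (rep_gen U + rep_gen V))
  | rel_tensor (U V : repr) :
      rep_relation (rep_gen (Representation (prod_repr U V))
                    - rep_gen U * rep_gen V)
  | rel_unit : rep_relation (rep_gen triv_repr - 1).

Inductive gen_ideal : freeR -> Prop :=
  | ideal_rel x of rep_relation x : gen_ideal x
  | ideal_0 : gen_ideal 0
  | ideal_lin a x y of gen_ideal x & gen_ideal y : gen_ideal (a * x + y).

Definition rep_ideal : {pred freeR} := fun x => `[< gen_ideal x >].

(* The dimension morphism, which shows that the ideal is proper. *)
Definition rdegree_monom (m : {cmonom repr}) : int :=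
  \prod_(U <- finsupp m) (rdegree U)%:Z ^+ m U.

Lemma rdegree_monomE (d : {fset repr}) (m : {cmonom repr}) :
  (finsupp m `<=` d)%fset ->
  rdegree_monom m = \prod_(U <- d) (rdegree U)%:Z ^+ m U.
Proof.
move=> le; rewrite /rdegree_monom (big_fset_incl _ le) //= => U Ud.
by rewrite -cmE_neq0 negbK => /eqP->; rewrite expr0.
Qed.

Fact rdegree_monom_mmorphism : mmorphism rdegree_monom.
Proof.
split=> [m1 m2|].
  rewrite (@rdegree_monomE (finsupp m1 `|` finsupp m2)%fset) ?mdomD //.
  rewrite (rdegree_monomE (fsubsetUl (finsupp m1) (finsupp m2))).
  rewrite (rdegree_monomE (fsubsetUr (finsupp m1) (finsupp m2))).
  by rewrite -big_split; apply: eq_bigr => U _; rewrite cmM exprD.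
by rewrite /rdegree_monom mdom1 big_seq_fset0.
Qed.

HB.instance Definition _ :=
  isMultiplicative.Build _ _ rdegree_monom rdegree_monom_mmorphism.

Definition free_rdegree : freeR -> int := mmap idfun rdegree_monom.
HB.instance Definition _ := GRing.RMorphism.on free_rdegree.

Lemma free_rdegree_gen U : free_rdegree (rep_gen U) = (rdegree U)%:Z.
Proof.
rewrite /free_rdegree rep_gen.unlock mmapU mul1r.
by rewrite /rdegree_monom mdomU big_seq_fset1 cmUU expr1.
Qed.

Lemma gen_ideal_rdegree x : gen_ideal x -> free_rdegree x = 0.
Proof.
elim=> {x} [x [U V UV|U V|U V|]||a x y _ x0 _ y0].
- by rewrite rmorphB /= !free_rdegree_gen (mxrank_rsim UV) subrr.
- by rewrite rmorphB rmorphD /= !free_rdegree_gen PoszD subrr.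
- by rewrite rmorphB rmorphM /= !free_rdegree_gen PoszM subrr.
- by rewrite rmorphB rmorph1 /= free_rdegree_gen subrr.
- by rewrite rmorph0.
by rewrite rmorphD rmorphM /= x0 y0 mulr0 addr0.
Qed.

Fact rep_ideal_closed : idealr_closed rep_ideal.
Proof.
split=> [||a x y xI yI]; first by apply/asboolP/ideal_0.
  by apply/asboolP => /gen_ideal_rdegree/eqP; rewrite rmorph1.
by apply/asboolP/ideal_lin; apply/asboolP.
Qed.

HB.instance Definition _ := isIdealr.Build freeR rep_ideal rep_ideal_closed.

Definition rep_ring := {ideal_quot rep_ideal}.
HB.instance Definition _ := GRing.ComNzRing.on rep_ring.

End RepresentationRing.

HB.lock Definition rep_class (F : fieldType) (gT : finGroupType)
    (G : {group gT}) (U : representation F G) : rep_ring F G :=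
  \pi_(rep_ring F G) (rep_gen U).

Section RepresentationClass.

Variables (F : fieldType) (gT : finGroupType) (G : {group gT}).
Local Notation repr := (representation F G).

Lemma rep_relation_pi (x y : free_rep_ring F G) :
  rep_relation (x - y) -> \pi_(rep_ring F G) x = \pi_(rep_ring F G) y.
Proof.
by move=> xy; apply/eqP; rewrite -Quotient.idealrBE; apply/asboolP/ideal_rel.
Qed.

Lemma rep_class_iso (U V : repr) : mx_rsim U V -> rep_class U = rep_class V.
Proof.
by move=> UV; rewrite rep_class.unlock; apply/rep_relation_pi/rel_iso.
Qed.

Lemma rep_class_dsum (U V : repr) :
  rep_class (dadd_grepr U V) = rep_class U + rep_class V.
Proof.
rewrite rep_class.unlock -rmorphD; exact/rep_relation_pi/rel_dsum.
Qed.

Lemma rep_class_tensor (U V : repr) :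
  rep_class (Representation (prod_repr U V)) = rep_class U * rep_class V.
Proof.
rewrite rep_class.unlock -rmorphM; exact/rep_relation_pi/rel_tensor.
Qed.

Lemma rep_class_triv : rep_class (triv_repr F G) = 1.
Proof.
rewrite rep_class.unlock -(rmorph1 \pi_(rep_ring F G)).
exact/rep_relation_pi/rel_unit.
Qed.

End RepresentationClass.

(* Z[s,t] is represented as Z[t][s]: the outer variable is s, the inner one t. *)
Definition var_s : {poly {poly int}} := 'X.
Definition var_t : {poly {poly int}} := 'X%:P.

Fixpoint fibpoly (m : nat) : {poly {poly int}} :=
  match m with
  | 0 => 0
  | 1 => 1
  | (m'.+1 as m1).+1 => var_s * fibpoly m1 + var_t * fibpoly m'
  end.

Definition fibfact (m : nat) : {poly {poly int}} :=
  \prod_(1 <= i < m.+1) fibpoly i.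

(* All divisors below are monic in s and the divisions are exact (see
   fibcatalan_exact), so that %/ is the usual quotient. *)
Definition fibonomial (m k : nat) : {poly {poly int}} :=
  fibfact m %/ (fibfact k * fibfact (m - k)).

Definition fibcatalan (n : nat) : {poly {poly int}} :=
  fibonomial n.*2 n %/ fibpoly n.+1.

Lemma fibpolySS m :
  fibpoly m.+2 = var_s * fibpoly m.+1 + var_t * fibpoly m.
Proof. by []. Qed.

Lemma fibpoly0 : fibpoly 0 = 0. Proof. by []. Qed.
Lemma fibpoly1 : fibpoly 1 = 1. Proof. by []. Qed.
Arguments fibpoly : simpl never.

Lemma fibpoly_monic_size m :
  fibpoly m.+1 \is monic /\ size (fibpoly m.+1) = m.+1.
Proof.
have [k le_mk] := ubnP m; elim: k m le_mk => // k IH [|[|m]] le_mk.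
- by rewrite monic1 size_poly1.
- by rewrite fibpolySS fibpoly0 fibpoly1 mulr1 mulr0 addr0 monicX size_polyX.
have [mon1 sz1] := IH m.+1 le_mk; have [mon0 sz0] := IH m (ltnW le_mk).
rewrite fibpolySS.
have szX : size (var_s * fibpoly m.+2) = m.+3.
  by rewrite mulrC size_mulX ?monic_neq0 // sz1.
have lt_sz : (size (var_t * fibpoly m.+1)%R < size (var_s * fibpoly m.+2)%R)%N.
  rewrite szX /var_t mul_polyC ltnS (leq_trans (size_scale_leq _ _)) //.
  by rewrite sz0.
split; last by rewrite size_polyDl.
by rewrite monicE lead_coefDl // mulrC lead_coefMX -monicE.
Qed.

Lemma fibpoly_monic m : fibpoly m.+1 \is monic.
Proof. by case: (fibpoly_monic_size m). Qed.

Lemma fibfact0 : fibfact 0 = 1.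
Proof. by rewrite /fibfact big_geq. Qed.

Lemma fibfactS m : fibfact m.+1 = fibfact m * fibpoly m.+1.
Proof. by rewrite /fibfact big_nat_recr. Qed.

Lemma fibfact_monic m : fibfact m \is monic.
Proof.
elim: m => [|m IH]; first by rewrite fibfact0 monic1.
by rewrite fibfactS monicMl // fibpoly_monic.
Qed.

Lemma fibpolyD m k :
  fibpoly (m + k).+1 = fibpoly m.+1 * fibpoly k.+1
                       + var_t * (fibpoly m * fibpoly k).
Proof.
have [l le_l] := ubnP m; elim: l m le_l => // l IH [|[|m]] le_l.
- by rewrite add0n fibpoly0 fibpoly1; ring.
- by rewrite add1n !fibpolySS fibpoly0 fibpoly1; ring.
have e1 := IH m.+1 le_l; have e0 := IH m (ltnW le_l); rewrite addSn in e1.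
rewrite !addSn fibpolySS e1 e0 !fibpolySS.
by ring.
Qed.

Lemma fibfact_dvd m k :
  exists q, fibfact (m + k) = q * (fibfact m * fibfact k).
Proof.
have [l le_l] := ubnP (m + k).
elim: l m k le_l => // l IH [|m] [|k] le_l.
- by exists 1; rewrite !fibfact0 !mul1r.
- by exists 1; rewrite add0n fibfact0 !mul1r.
- by exists 1; rewrite addn0 fibfact0 mul1r mulr1.
have [q1 e1] := IH m k.+1 le_l.
have [|q2 e2] := IH m.+1 k; first by rewrite addSnnS.
rewrite addSn addnS in le_l *; rewrite fibfactS.
have -> : fibpoly (m + k).+2 = fibpoly m.+1 * fibpoly k.+2
                               + var_t * (fibpoly m * fibpoly k.+1).
  by rewrite -addnS fibpolyD.
rewrite -addnS mulrDr {1}e1 addnS -addSn e2 !fibfactS.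
exists (q1 * fibpoly k.+2 + q2 * (var_t * fibpoly m)).
by ring.
Qed.

Lemma fibonomial_exact m k : (k <= m)%N ->
  fibonomial m k * (fibfact k * fibfact (m - k)) = fibfact m.
Proof.
move=> le_km; rewrite /fibonomial.
have [q] := fibfact_dvd k (m - k); rewrite subnKC // => ->.
by rewrite Pdiv.IdomainMonic.mulpK // monicMl ?fibfact_monic.
Qed.

Lemma fibpoly_cassini n :
  fibpoly n.+1 ^+ 2 - fibpoly n.+2 * fibpoly n = (- var_t) ^+ n.
Proof.
elim: n => [|n IH]; first by rewrite fibpoly0 fibpoly1 mulr0 subr0 expr0 expr1n.
by rewrite [RHS]exprS -IH !fibpolySS; ring.
Qed.

Lemma fibcatalan_exact n :
  fibcatalan n * fibpoly n.+1 = fibonomial n.*2 n.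
Proof.
case: n => [|n].
  by rewrite /fibcatalan /fibonomial /= divp1 mulr1.
set B := fibonomial _ _; rewrite /fibcatalan -/B.
pose B' := fibonomial n.+1.*2 n.
have eB : B * (fibfact n.+1 * fibfact n.+1) = fibfact n.+1.*2.
  have := @fibonomial_exact n.+1.*2 n.+1; rewrite -addnn addnK leq_addr.
  by rewrite addnn; apply.
have eB' : B' * (fibfact n * fibfact n.+2) = fibfact n.+1.*2.
  have := @fibonomial_exact n.+1.*2 n.
  have -> : (n.+1.*2 - n = n.+2)%N by rewrite -addnn addSnnS addnC addnK.
  by apply; rewrite -addnn addSnnS leq_addr.
have e : B * fibpoly n.+1 = B' * fibpoly n.+2.
  apply: (mulIf (x := fibfact n * fibfact n.+1)).
    by rewrite mulf_neq0 ?monic_neq0 ?fibfact_monic.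
  transitivity (fibfact n.+1.*2); [rewrite -eB | rewrite -eB'];
    rewrite !fibfactS; ring.
have mon := fibpoly_monic n.+1.
have monic_unit : lead_coef (fibpoly n.+2) \is a GRing.unit.
  by rewrite (monicP mon) unitr1.
have : (B * (- var_t) ^+ n) %% fibpoly n.+2 = 0.
  have -> : B * (- var_t) ^+ n
          = (B' * fibpoly n.+1 - B * fibpoly n) * fibpoly n.+2.
    rewrite -fibpoly_cassini mulrBr expr2 mulrA e; ring.
  exact: modp_mull.
rewrite -polyCN -polyC_exp mulrC mul_polyC
  (Pdiv.IdomainUnit.modpZl monic_unit).
move/eqP; rewrite -mul_polyC mulf_eq0 polyC_eq0 expf_eq0 oppr_eq0 polyX_eq0.
rewrite andbF /= => /eqP r0.
by rewrite [RHS](Pdiv.IdomainMonic.divp_eq mon) r0 addr0.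
Qed.

Lemma modn_add_small N x i : (x < N)%N -> (i < N)%N ->
  ((x + i) %% N = if x + i < N then x + i else x + i - N)%N.
Proof.
move=> xN iN; case: ltnP => [/modn_small //|le].
by rewrite -[in LHS](subnK le) modnDr modn_small //; lia.
Qed.

Lemma cyclic_order_add N i (r : nat -> nat) a b c d :
    (forall x, x < N -> r x = if x + i < N then x + i else x + i - N)%N ->
    (a < b)%N -> (b < c)%N -> (c < d)%N -> (d < N)%N -> (i < N)%N ->
  [|| [&& r a < r b, r b < r c & r c < r d],
      [&& r d < r a, r a < r b & r b < r c],
      [&& r c < r d, r d < r a & r a < r b] |
      [&& r b < r c, r c < r d & r d < r a]]%N.
Proof.
move=> rE ab bc cd dN iN.
have cN := ltn_trans cd dN; have bN := ltn_trans bc cN.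
have aN := ltn_trans ab bN.
have {}rE x : (x < N)%N ->
    (x + i < N)%N /\ r x = (x + i)%N \/ (N <= x + i)%N /\ r x = (x + i - N)%N.
  by move=> xN; rewrite rE //; case: ltnP; [left | right].
move: (rE a aN) (rE b bN) (rE c cN) (rE d dN) => {rE}.
move: (r a) (r b) (r c) (r d) => ra rb rc rd.
case=> -[wa ->]; case=> -[wb ->]; case=> -[wc ->]; case=> -[wd ->];
  try by exfalso; clear -ab bc cd dN iN wa wb wc wd; lia.
- by apply/or4P/Or41/and3P; split; clear -ab bc cd dN iN wa wb wc wd; lia.
- by apply/or4P/Or42/and3P; split; clear -ab bc cd dN iN wa wb wc wd; lia.
- by apply/or4P/Or43/and3P; split; clear -ab bc cd dN iN wa wb wc wd; lia.
- by apply/or4P/Or44/and3P; split; clear -ab bc cd dN iN wa wb wc wd; lia.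
by apply/or4P/Or41/and3P; split; clear -ab bc cd dN iN wa wb wc wd; lia.
Qed.

Lemma cyclic_order_opp N (r : nat -> nat) a b c d :
    r 0%N = 0%N -> (forall x, 0 < x < N -> r x = N - x)%N ->
    (a < b)%N -> (b < c)%N -> (c < d)%N -> (d < N)%N ->
  [&& r d < r c, r c < r b & r b < r a]%N
  || [&& r a < r d, r d < r c & r c < r b]%N.
Proof.
move=> r0 rE ab bc cd dN.
rewrite (rE b) ?(rE c) ?(rE d); [|clear -ab bc cd dN; lia..].
case: (posnP a) => [a0|a0].
  rewrite a0 r0; apply/orP; right; clear -ab bc cd dN.
  by apply/and3P; split; lia.
rewrite rE; last by clear -a0 ab bc cd dN; lia.
by apply/orP; left; clear -ab bc cd dN; apply/and3P; split; lia.
Qed.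

(* The element r ^ i * s ^ b of the dihedral group I_2(n), for n >= 2 (recall
   that 'Z_n is Z/2Z when n < 2). *)
Record dihedral (n : nat) := Dih {dih_rot : 'Z_n; dih_refl : bool}.

Section DihedralGroup.

Variable n : nat.
Local Notation D := (dihedral n).

Definition dih_pair (g : D) := (dih_rot g, dih_refl g).
Definition pair_dih (p : 'Z_n * bool) : D := Dih p.1 p.2.
Fact dih_pairK : cancel dih_pair pair_dih. Proof. by case. Qed.

HB.instance Definition _ := Finite.copy D (can_type dih_pairK).

Definition dih_one : D := Dih 0 false.
Definition dih_mul (g h : D) : D :=
  Dih (dih_rot g + (-1) ^+ dih_refl g * dih_rot h)
      (dih_refl g (+) dih_refl h).
Definition dih_inv (g : D) : D :=
  Dih (- (-1) ^+ dih_refl g * dih_rot g) (dih_refl g).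

Fact dih_mulA : associative dih_mul.
Proof.
move=> [i b] [j c] [k d]; rewrite /dih_mul /= addbA signr_addb; congr Dih.
by ring.
Qed.

Fact dih_mul1 : left_id dih_one dih_mul.
Proof. by case=> i b; rewrite /dih_mul /= expr0 mul1r add0r. Qed.

Fact dih_mulV : left_inverse dih_one dih_inv dih_mul.
Proof.
by case=> i b; rewrite /dih_mul /dih_one /= addbb mulNr addNr.
Qed.

HB.instance Definition _ := Finite_isGroup.Build D dih_mulA dih_mul1 dih_mulV.

Definition dih_r : D := Dih 1 false.
Definition dih_s : D := Dih 0 true.

Lemma dih_mulE (g h : D) :
  (g * h)%g = Dih (dih_rot g + (-1) ^+ dih_refl g * dih_rot h)
                  (dih_refl g (+) dih_refl h).
Proof. by []. Qed.

Lemma dih_invE (g : D) :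
  g^-1%g = Dih (- (-1) ^+ dih_refl g * dih_rot g) (dih_refl g).
Proof. by []. Qed.

Lemma dih_oneE : 1%g = Dih 0 false :> D.
Proof. by []. Qed.

Lemma dih_rX k : (dih_r ^+ k)%g = Dih k%:R false.
Proof.
elim: k => [|k IH] //; rewrite expgS IH dih_mulE /= expr0 mul1r.
by rewrite -natr1 addrC.
Qed.

Lemma dihE (g : D) : g = (dih_r ^+ dih_rot g * dih_s ^+ dih_refl g)%g.
Proof.
case: g => i b; rewrite dih_rX /= natr_Zp.
case: b; last by rewrite mulg1.
by rewrite expg1 dih_mulE /= mulr0 addr0.
Qed.

Lemma card_dihedral_type : (1 < n)%N -> #|[set: D]| = n.*2.
Proof.
move=> n_gt1; have bij : bijective dih_pair by exists pair_dih => //; case.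
by rewrite cardsT (bij_eq_card bij) card_prod card_bool card_ord Zp_cast // muln2.
Qed.

Lemma dihedral_Grp : (1 < n)%N ->
  ([set: D] \isog Grp (x : y : x ^+ n, y ^+ 2, x * y = y * x^-1))%g.
Proof.
move=> n_gt1; apply: intro_isoGrp => [|rT H].
  apply/existsP; exists (dih_r, dih_s); rewrite /= !xpair_eqE /=.
  apply/and4P; split.
  - rewrite eqEsubset subsetT /=; apply/subsetP => g _; rewrite (dihE g).
    by rewrite groupM // groupX // mem_gen // inE cycle_id ?orbT.
  - by rewrite dih_rX pchar_Zp.
  - by rewrite expgS expg1 dih_mulE /= mulr0 addr0.
  by rewrite !dih_mulE dih_invE /= !(mulN1r, mul1r, opprK, mulr0, add0r, addr0).
case/existsP=> -[x y] /= /eqP[defH xn y2 xy].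
pose f (g : D) := (x ^+ dih_rot g * y ^+ dih_refl g)%g.
have xZp (i j : 'Z_n) : (x ^+ (i + j)%R = x ^+ i * x ^+ j)%g.
  by rewrite /= {3}Zp_cast // expg_mod // expgD.
have xN (i : 'Z_n) : (x ^+ (- i)%R = x^-1 ^+ i)%g.
  by apply: (mulgI (x ^+ i)%g); rewrite -xZp subrr expgVn mulgV.
have yx (i : nat) : (y * x ^+ i = x^-1 ^+ i * y)%g.
  elim: i => [|i IH]; first by rewrite !expg0 mulg1 mul1g.
  rewrite expgSr mulgA IH -!mulgA expgSr -mulgA; congr (_ * _)%g.
  by apply: (mulgI x); rewrite mulgA xy mulgKV mulKVg.
have fM : {in [set: D] &, {morph f : g h / (g * h)%g}}.
  have fE i b : f (Dih i b) = (x ^+ i * y ^+ b)%g by [].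
  move=> [i b] [j c] _ _.
  rewrite -[(_ * _)%g]/(Dih (i + (-1) ^+ b * j) (b (+) c)) !fE.
  case: b; last by rewrite expr0 mul1r xZp mulg1 mulgA.
  rewrite expr1 mulN1r xZp xN expg1 -!mulgA; congr (_ * _)%g.
  rewrite [RHS]mulgA yx -mulgA; congr (_ * _)%g.
  by case: c; rewrite /= ?mulg1 // expg1 -y2 expgS expg1.
have fG g : f g \in (Morphism fM @* [set: D])%g.
  by rewrite /morphim setIid; apply: imset_f.
have fy : (y \in Morphism fM @* [set: D])%g.
  by have := fG (Dih 0 true); rewrite /f mul1g.
have x1 : (x ^+ (1%R : 'Z_n) = x)%g by case: n n_gt1 => [|[|m]].
have fx : (x \in Morphism fM @* [set: D])%g.
  by have := fG (Dih 1 false); rewrite /f mulg1 x1.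
apply/homgP; exists (Morphism fM); rewrite -defH; apply/eqP.
rewrite eqEsubset join_subG !cycle_subG fx fy !andbT.
rewrite /morphim setIid; apply/subsetP => _ /imsetP[g _ ->]; rewrite /= /f.
by rewrite groupM // groupX // mem_gen // inE cycle_id ?orbT.
Qed.

(* MathComp actions are right actions: i is first rotated, then reflected. *)
Definition vertex_act (i : 'Z_n) (g : D) : 'Z_n :=
  (-1) ^+ dih_refl g * (i + dih_rot g).

Fact vertex_act1 : vertex_act^~ 1%g =1 id.
Proof. by move=> i; rewrite /vertex_act /= expr0 mul1r addr0. Qed.

Fact vertex_actM i : act_morph vertex_act i.
Proof.
move=> [j b] [k c]; rewrite /vertex_act dih_mulE /= signr_addb.
by case: b; case: c; rewrite /= ?(expr0, expr1); ring.
Qed.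

Definition vertex_action := TotalAction vertex_act1 vertex_actM.

Lemma vertex_act_r i : vertex_action i dih_r = i + 1.
Proof. by rewrite /= /vertex_act expr0 mul1r. Qed.

Lemma vertex_act_s i : vertex_action i dih_s = - i.
Proof. by rewrite /= /vertex_act addr0 mulN1r. Qed.

(* The vertex i : 'Z_n carries the label i of [n], the label n being written 0.
   Crossing depends only on the cyclic order of the labels, so it can be read
   off the order 0 < 1 < ... < n - 1. *)
Definition crossing (B C : {set 'Z_n}) : bool :=
  [exists a in B, exists b in C, exists c in B, exists d in C,
     [&& (a < b)%N, (b < c)%N & (c < d)%N]].

Definition noncrossing (P : {set {set 'Z_n}}) : bool :=
  [forall B in P, forall C in P, (B != C) ==> ~~ crossing B C].

Definition ncpart := {P : {set {set 'Z_n}} | partition P setT && noncrossing P}.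
HB.instance Definition _ := Finite.on ncpart.

Lemma crossingP (B C : {set 'Z_n}) :
  reflect (exists a b c d : 'Z_n,
             [/\ a \in B, b \in C, c \in B & d \in C] /\
             [/\ (a < b)%N, (b < c)%N & (c < d)%N])
          (crossing B C).
Proof.
apply: (iffP exists_inP) => [[a aB]|[a [b [c [d [[aB bC cB dC] lt]]]]]].
  case/exists_inP=> b bC /exists_inP[c cB /exists_inP[d dC /and3P lt]].
  by exists a, b, c, d.
exists a => //; apply/exists_inP; exists b => //; apply/exists_inP; exists c => //.
by apply/exists_inP; exists d => //; apply/and3P.
Qed.

Definition crossing_sym (B C : {set 'Z_n}) := crossing B C || crossing C B.

Lemma crossing_symC B C : crossing_sym B C = crossing_sym C B.
Proof. exact: orbC. Qed.

Lemma crossing_symI (B C : {set 'Z_n}) (a b c d : 'Z_n) :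
  a \in B -> b \in C -> c \in B -> d \in C ->
  (a < b)%N -> (b < c)%N -> (c < d)%N -> crossing_sym B C.
Proof. by move=> *; apply/orP; left; apply/crossingP; exists a, b, c, d. Qed.

Lemma crossing_imset (h : 'Z_n -> 'Z_n) :
    (forall B C, crossing B C -> crossing_sym (h @: B) (h @: C)) ->
  forall B C, crossing_sym B C -> crossing_sym (h @: B) (h @: C).
Proof.
by move=> hP B C /orP[/hP //|/hP]; rewrite crossing_symC.
Qed.

Lemma crossing_add i B C :
  crossing B C -> crossing_sym [set x + i | x in B] [set x + i | x in C].
Proof.
case/crossingP=> a [b [c [d [[aB bC cB dC] [ab bc cd]]]]].
have im (A : {set 'Z_n}) x : x \in A -> x + i \in [set x + i | x in A].
  by move=> xA; apply: imset_f.
move: (im _ _ aB) (im _ _ bC) (im _ _ cB) (im _ _ dC) => aB' bC' cB' dC'.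
have rE x : (x < (Zp_trunc n).+2)%N -> ((x + i) %% (Zp_trunc n).+2 =
    if x + i < (Zp_trunc n).+2 then x + i else x + i - (Zp_trunc n).+2)%N.
  by move=> xN; apply: modn_add_small.
have /or4P[] := cyclic_order_add rE ab bc cd (ltn_ord d) (ltn_ord i).
- by case/and3P=> *; apply: (crossing_symI aB' bC' cB' dC').
- by case/and3P=> *; rewrite crossing_symC; apply: (crossing_symI dC' aB' bC' cB').
- by case/and3P=> *; apply: (crossing_symI cB' dC' aB' bC').
by case/and3P=> *; rewrite crossing_symC; apply: (crossing_symI bC' cB' dC' aB').
Qed.

Lemma crossing_opp B C :
  crossing B C -> crossing_sym [set - x | x in B] [set - x | x in C].
Proof.
case/crossingP=> a [b [c [d [[aB bC cB dC] [ab bc cd]]]]].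
have im (A : {set 'Z_n}) x : x \in A -> - x \in [set - x | x in A].
  by move=> xA; apply: imset_f.
move: (im _ _ aB) (im _ _ bC) (im _ _ cB) (im _ _ dC) => aB' bC' cB' dC'.
pose r x := (((Zp_trunc n).+2 - x) %% (Zp_trunc n).+2)%N.
have r0 : r 0%N = 0%N by rewrite /r subn0 modnn.
have rE x : (0 < x < (Zp_trunc n).+2 -> r x = (Zp_trunc n).+2 - x)%N.
  by move=> x0; apply: modn_small; lia.
have /orP[] := cyclic_order_opp r0 rE ab bc cd (ltn_ord d).
- by case/and3P=> *; rewrite crossing_symC; apply: (crossing_symI dC' cB' bC' aB').
by case/and3P=> *; apply: (crossing_symI aB' dC' cB' bC').
Qed.

Lemma crossing_act B C g :
  crossing_sym (vertex_action^* B g)%act (vertex_action^* C g)%act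
    = crossing_sym B C.
Proof.
have act_imp A1 A2 h : crossing_sym A1 A2 ->
    crossing_sym (vertex_action^* A1 h)%act (vertex_action^* A2 h)%act.
  have hE A : (vertex_action^* A h)%act =
      if dih_refl h then [set - x | x in [set x + dih_rot h | x in A]]
      else [set x + dih_rot h | x in A].
    case: ifP => hr; rewrite /= /setact -?imset_comp; apply: eq_imset => x /=;
      by rewrite /vertex_act hr ?mulN1r ?mul1r.
  move=> cr; rewrite !hE; case: ifP => _.
    apply: (crossing_imset crossing_opp).
    by apply: (crossing_imset (@crossing_add (dih_rot h))).
  by apply: (crossing_imset (@crossing_add (dih_rot h))).
apply/idP/idP => [/(act_imp _ _ g^-1%g)|]; last exact: act_imp.
by rewrite -!actM mulgV !act1.
Qed.

Fact ncpart_act_subproof (P : ncpart) (g : D) :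
  partition (vertex_action^*^* (val P) g)%act setT
  && noncrossing (vertex_action^*^* (val P) g)%act.
Proof.
case: P => P /= /andP[partP ncP]; apply/andP; split.
  have imT : vertex_action^~ g @: [set: 'Z_n] = [set: 'Z_n].
    apply/setP => x; rewrite inE; apply/imsetP.
    by exists (vertex_action x g^-1%g); rewrite ?actKV.
  by rewrite -[X in partition _ X]imT /setact imset_partition //; apply: act_inj.
have nc B C : B \in P -> C \in P -> B != C -> ~~ crossing_sym B C.
  move=> BP CP BC; rewrite /crossing_sym negb_or.
  have /forall_inP ncP1 := ncP.
  have /forall_inP/(_ C CP)/implyP/(_ BC)-> := ncP1 B BP.
  have /forall_inP/(_ B BP)/implyP-> // := ncP1 C CP.
  by rewrite eq_sym.
apply/forall_inP => _ /imsetP[B BP ->]; apply/forall_inP => _ /imsetP[C CP ->].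
apply/implyP => BC; have {}BC : B != C by apply: contraNneq BC => ->.
by have := nc B C BP CP BC; rewrite -(crossing_act B C g) negb_or => /andP[].
Qed.

Definition ncpart_act (P : ncpart) (g : D) : ncpart :=
  Sub (vertex_action^*^* (val P) g)%act (ncpart_act_subproof P g).

Fact ncpart_act1 : ncpart_act^~ 1%g =1 id.
Proof. by move=> P; apply: val_inj; rewrite /= act1. Qed.

Fact ncpart_actM P : act_morph ncpart_act P.
Proof. by move=> g h; apply: val_inj; rewrite /= actM. Qed.

Definition ncpart_action := TotalAction ncpart_act1 ncpart_actM.

End DihedralGroup.

Section PermutationRepresentation.

Variables (F : fieldType) (gT : finGroupType) (X : finType).
Variable to : {action gT &-> X}.

(* Row-vector convention of mx_representation: e_x *m perm_mx_of g = e_(x g). *)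
Definition perm_mx_of (g : gT) : 'M[F]_#|X| :=
  \matrix_(i, j) (to (enum_val i) g == enum_val j)%:R.

Fact perm_mx_repr : mx_repr [set: gT] perm_mx_of.
Proof.
split=> [|g h _ _]; apply/matrixP => i j; rewrite !mxE.
  by rewrite act1 (inj_eq enum_val_inj).
rewrite (bigD1 (enum_rank (to (enum_val i) g))) //= !mxE enum_rankK eqxx mul1r.
rewrite big1 ?addr0 ?actM // => k nk; rewrite !mxE.
have /negPf-> : to (enum_val i) g != enum_val k.
  by apply: contraNneq nk => ->; rewrite enum_valK.
by rewrite mul0r.
Qed.

Definition perm_repr : representation F [set: gT] :=
  Representation (MxRepresentation perm_mx_repr).

End PermutationRepresentation.

Section DihedralRepresentations.

Variables (R : realType) (n : nat).
Local Notation D := (dihedral n).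

Definition rotation_mx (x : R) : 'M[R[i]]_2 :=
  \matrix_(i, j) (if i == j then cos x
                  else if i == 0 then - sin x else sin x)%:C%C.

Definition reflection_mx : 'M[R[i]]_2 :=
  \matrix_(i, j) (if i == j then (if i == 0 then 1 else -1) else 0).

Definition z1_mx (g : D) : 'M[R[i]]_2 :=
  rotation_mx (pi *+ 2 / n%:R *+ dih_rot g) *m (if dih_refl g then reflection_mx else 1).

Fact rotation_mxD x y :
  rotation_mx (x + y) = rotation_mx x *m rotation_mx y.
Proof.
apply/matrixP => i j; rewrite !mxE big_ord_recr big_ord1 /= !mxE.
case: i => -[|[|//]] hi; case: j => -[|[|//]] hj; rewrite /= ?cosD ?sinD.
all: rewrite ?(rmorphD, rmorphN, rmorphM) /=; ring.
Qed.

Fact rotation_mx0 : rotation_mx 0 = 1.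
Proof.
apply/matrixP => i j; rewrite !mxE cos0 sin0 oppr0 if_same.
by case: eqP.
Qed.

Fact reflection_mx_rot x :
  reflection_mx *m rotation_mx x = rotation_mx (- x) *m reflection_mx.
Proof.
apply/matrixP => i j; rewrite !mxE !big_ord_recr !big_ord0 /= !mxE ?cosN ?sinN.
case: i => -[|[|//]] hi; case: j => -[|[|//]] hj; rewrite /=.
all: rewrite ?opprK ?rmorphN /=; ring.
Qed.

Fact reflection_mxK : reflection_mx *m reflection_mx = 1.
Proof.
apply/matrixP => i j; rewrite !mxE !big_ord_recr !big_ord0 /= !mxE.
by case: i => -[|[|//]] hi; case: j => -[|[|//]] hj; rewrite /=; ring.
Qed.

Let w : R := pi *+ 2 / n%:R.

Fact rotation_mx_Zp k :
  rotation_mx (w *+ (k %% (Zp_trunc n).+2)%N) = rotation_mx (w *+ k).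
Proof.
have [m wN] : exists m, w *+ (Zp_trunc n).+2 = pi *+ 2 *+ m.
  rewrite /w; case: (n) => [|[|m]].
  - by exists 0%N; rewrite invr0 mulr0 mul0rn.
  - by exists 2%N; rewrite divr1.
  by exists 1%N; rewrite -[LHS]mulr_natr divfK // pnatr_eq0.
have rot2pi l : rotation_mx (pi *+ 2 *+ l) = 1.
  rewrite -rotation_mx0 -[_ *+ l]add0r; apply/matrixP => i j; rewrite !mxE.
  by rewrite !(periodicn (@cosD2pi R)) !(periodicn (@sinD2pi R)).
rewrite [in RHS](divn_eq k (Zp_trunc n).+2) mulrnDr mulnC mulrnA wN -mulrnA.
by rewrite rotation_mxD rot2pi mul1mx.
Qed.

Fact z1_mx_repr : mx_repr [set: D] z1_mx.
Proof.
split=> [|[i b] [j c] _ _]; first by rewrite /z1_mx mulr0n rotation_mx0 mul1mx.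
have rotD (k l : 'Z_n) :
    rotation_mx (w *+ (k + l)%R) = rotation_mx (w *+ k) *m rotation_mx (w *+ l).
  by rewrite rotation_mx_Zp mulrnDr rotation_mxD.
have rotN (l : 'Z_n) : rotation_mx (w *+ (- l)%R) = rotation_mx (- (w *+ l)).
  rewrite rotation_mx_Zp mulrnBr; last exact/ltnW/ltn_ord.
  by rewrite rotation_mxD -(rotation_mx_Zp _.+2) modnn mulr0n rotation_mx0 mul1mx.
rewrite dih_mulE /z1_mx; case: b; last first.
  by rewrite [dih_rot _]/= expr0 mul1r rotD !mulmx1 -!mulmxA.
rewrite [dih_rot _]/= expr1 mulN1r rotD rotN -!mulmxA; congr (_ *m _).
rewrite [RHS]mulmxA reflection_mx_rot -mulmxA; congr (_ *m _).
by case: c; rewrite /= ?mulmx1 // reflection_mxK.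
Qed.

Definition z1_repr : representation R[i] [set: D] :=
  Representation (MxRepresentation z1_mx_repr).

Definition det_mx (g : D) : 'M[R[i]]_1 := ((-1) ^+ dih_refl g)%:M.

Fact det_mx_repr : mx_repr [set: D] det_mx.
Proof.
split=> [|g h _ _]; rewrite /det_mx ?expr0 //.
by rewrite dih_mulE /= signr_addb -scalar_mxM.
Qed.

Definition det_repr : representation R[i] [set: D] :=
  Representation (MxRepresentation det_mx_repr).

Lemma z1_repr_r : (1 < n)%N -> z1_repr (dih_r n) = rotation_mx (pi *+ 2 / n%:R).
Proof.
move=> n_gt1; rewrite /= /z1_mx mulmx1 /=.
by case: n n_gt1 => [|[|m]].
Qed.

Lemma z1_repr_s : z1_repr (dih_s n) = reflection_mx.
Proof. by rewrite /= /z1_mx mulr0n rotation_mx0 mul1mx. Qed.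

(* The value P(z_1, - det) in Rep(I_2(n)) of P in Z[t][s]. *)
Definition sieving_eval (P : {poly {poly int}}) : rep_ring R[i] [set: D] :=
  (map_poly (map_poly intr) P).[(rep_class z1_repr)%:P].[- rep_class det_repr].

Lemma sieving_eval_s : sieving_eval var_s = rep_class z1_repr.
Proof. by rewrite /sieving_eval map_polyX hornerX hornerC. Qed.

Lemma sieving_eval_t : sieving_eval var_t = - rep_class det_repr.
Proof. by rewrite /sieving_eval map_polyC hornerC /= map_polyX hornerX. Qed.

Definition dihedral_sieving (X : finType) (to : {action D &-> X})
    (P : {poly {poly int}}) : Prop :=
  rep_class (perm_repr R[i] to) = sieving_eval P.

End DihedralRepresentations.

(* Main.v *)
Require Import Defs.
From HB Require Import structures.
From mathcomp Require Import all_boot all_order all_fingroup all_algebra pgroup.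
From mathcomp Require Import mxrepresentation character complex.
From mathcomp Require Import boolp reals trigo.
From mathcomp Require Import zify ring.

Set Implicit Arguments.
Unset Strict Implicit.
Unset Printing Implicit Defensive.

Import Order.TTheory GRing.Theory Num.Theory.

(** Over an algebraically closed field of characteristic 0 a representation is
determined by its traces, and traces turn direct sums and tensor products into
sums and products. So an equality between the class of a permutation
representation and a polynomial in z_1 and - det can be checked by comparing, for
each group element g, the number of fixed points of g with the value of the
polynomial at s = tr z_1(g), t = - det(g) ([dihedral_sieving_fixed]).

The values of the polynomial. Let {m} be the Fibonacci polynomials. At the
identity, s = 2 and t = -1, so {m} = m and the value is the Catalan number. At a
rotation by the angle x, s = 2 cos x and t = -1, so {m} = sin (m x) / sin x; if
the rotation has order d, then {m} vanishes exactly at the multiples of d. At a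
reflection, s = 0 and t = 1, so {m} vanishes exactly for m even. In the last two
cases the quotient of factorials has the form 0 / 0, and it is resolved by writing
{jd} = {d} q_j, where q_j takes the value j, and by cancelling the powers of {d}
before evaluating. With m = n / d the value at a rotation is binomial (2m, m)
([fibcatalan_value_rot]), and the value at a reflection is
binomial (n, (n - 1) / 2) ([fibcatalan_value_refl]).

The fixed points. A non-crossing equivalence relation on the integers is
determined by knowing, for each x, whether x is the least and whether it is the
greatest element of its class ([noncrossing_eq]). Written as up and down steps,
two for each integer, this information is a lattice path, and the relation is
recovered from the path by joining points at equal height that see each other
above the path ([level], [word_level_word]). Relations that are periodic with
period m correspond in this way to balanced words of length 2m. This
correspondence is used twice.

- With m = n, cutting the circle between two labels identifies all non-crossing
  partitions with Dyck words of length 2n, which the Catalan numbers count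
  ([card_ncpart]). The reflection that preserves the cut reverses and negates the
  word, so its fixed points are the nonnegative words of length n
  ([card_fixed_refl]).

- A partition that is invariant under a rotation of order d >= 3 by m = n / d
  steps unrolls, around the centre of the disk, to a relation of period m, and
  each balanced word of length 2m occurs. The count is binomial (2m, m)
  ([card_fixed_rot]). A rotation other than the identity has order at least 3
  because n is odd; this is what makes the lift of a block unambiguous. *)

Local Open Scope ring_scope.
Local Open Scope complex_scope.


(** * Traces determine classes in the representation ring *)

Lemma rep_class_degree0 (F : fieldType) (gT : finGroupType) (G : {group gT})
    (U : representation F G) : rdegree U = 0%N -> rep_class U = 0.
Proof.
move=> U0; apply: (addIr (rep_class U)); rewrite add0r -rep_class_dsum.
apply: rep_class_iso; exists 0 => [||g _] /=.
- by rewrite U0.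
- by rewrite /row_free mxrank0 U0.
by rewrite mul0mx mulmx0.
Qed.

Section CharacterDeterminesClass.

Local Open Scope group_scope.
Local Open Scope ring_scope.

Variables (F : closedFieldType) (gT : finGroupType) (G : {group gT}).
Hypothesis F0 : [pchar F] =i pred0.
Local Notation repr := (representation F G).

Let FG : ([pchar F]^').-group G.
Proof. by apply/pgroupP => p _ _; rewrite inE /= F0. Qed.

Lemma mxtrace_gring_op (U : repr) A :
  \tr (gring_op U A) = \sum_(i < gcard G) gring_row A 0 i * \tr (U (enum_val i)).
Proof.
rewrite gring_opE; move: (gring_row A) => v.
rewrite [in LHS](row_sum_delta v) !linear_sum /=.
apply: eq_bigr => i _; rewrite !linearZ /=; congr (_ * \tr _).
by rewrite /gring_mx /= -rowE rowK mxvecK.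
Qed.

Let sG : irrType F G := DecSocleType (regular_repr F G).
Let irr_rep (i : sG) : repr := Representation (irr_repr i).

(** By Maschke's theorem a simple submodule splits off, so induction on the degree
writes a class as a sum of classes of irreducibles. The irreducibles are indexed
by the Wedderburn components of the regular representation. *)
Lemma rep_class_semisimple (U : repr) :
  exists s : seq sG, rep_class U = \sum_(i <- s) rep_class (irr_rep i)
    /\ {in G, forall g, \tr (U g) = \sum_(i <- s) \tr (irr_rep i g)}.
Proof.
have [n ltn] := ubnP (rdegree U); elim: n U ltn => // n IH [k rG] /=.
rewrite ltnS => le_kn; have [k0|k_gt0] := posnP k.
  exists nil; rewrite !big_nil; split; first exact: rep_class_degree0.
  by move=> g _; rewrite big_nil /mxtrace big1 // => i _; have := ltn_ord i; rewrite {2}k0.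
have [|M simM _] := dec_mxsimple_exists (mxmodule1 rG).
  by rewrite -mxrank_eq0 mxrank1 -lt0n.
have [modM nzM _] := simM.
have [W modW defMW dxMW] := mx_Maschke_pchar rG FG modM (submx1 M).
have mod1 := mxmodule1 rG.
pose rM : repr := Representation (submod_repr modM).
pose rW : repr := Representation (submod_repr modW).
have simdadd : mx_rsim rG (dadd_grepr rM rW).
  apply: mx_rsim_trans (mx_rsim_sym (rsim_submod1 mod1 (eqmx_refl _))) _.
  by apply: (@mx_rsim_dadd _ _ _ _ _ _ _ _ rM rW modM modW mod1 defMW dxMW);
    apply: mx_rsim_refl.
have irrM : mx_irreducible rM by apply/submod_mx_irr.
have rankMW : (\rank M + \rank W = k)%N.
  by rewrite -(mxdirectP dxMW) /= defMW mxrank1.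
have [|s [eq_cl eq_tr]] := IH rW.
  apply: leq_trans le_kn => /=; rewrite -[X in (_ <= X)%N]rankMW.
  by rewrite -[X in (X < _)%N]add0n ltn_add2r lt0n mxrank_eq0.
have simM' := rsim_irr_comp_pchar sG FG irrM.
exists (irr_comp sG rM :: s); rewrite !big_cons; split.
  transitivity (rep_class rM + rep_class rW).
    by rewrite -rep_class_dsum; apply: rep_class_iso.
  by rewrite eq_cl; congr (_ + _); apply: rep_class_iso.
move=> g Gg; rewrite big_cons -eq_tr // -(mxtrace_rsim simM') //.
by rewrite (mxtrace_rsim simdadd) //= mxtrace_block.
Qed.

Lemma mxtrace_Wedderburn_id (i j : sG) :
  \tr (gring_op (irr_rep j) (Wedderburn_id i))
    = (irr_degree i)%:R *+ (j == i).
Proof.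
have [->|ne] := eqVneq; first by rewrite op_Wedderburn_id_pchar // mxtrace1.
have := irr_repr'_op0_pchar FG (A := Wedderburn_id i) (i := j) (j := i).
by rewrite eq_sym => -> //; rewrite ?linear0 // Wedderburn_id_mem.
Qed.

(** The Wedderburn idempotent of a component acts as the identity on the matching
irreducible and as zero on the others, so its trace recovers the multiplicity of
that irreducible; in characteristic 0 the multiplicity is read off exactly. Only
equality in the ring is claimed, which avoids rearranging direct sums. *)
Theorem rep_class_trace (U V : repr) :
  {in G, forall g, \tr (U g) = \tr (V g)} -> rep_class U = rep_class V.
Proof.
move=> eqUV.
have [s [-> sE]] := rep_class_semisimple U.
have [t [-> tE]] := rep_class_semisimple V.
apply: perm_big; apply/allP => i _; apply/eqP.
have cnt (W : repr) (u : seq sG) :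
    {in G, forall g, \tr (W g) = \sum_(i <- u) \tr (irr_rep i g)} ->
  \tr (gring_op W (Wedderburn_id i)) = (irr_degree i)%:R *+ count_mem i u.
  move=> uE; rewrite mxtrace_gring_op.
  under eq_bigr => k _ do rewrite uE ?enum_valP // mulr_sumr.
  rewrite exchange_big /= -sum1_count -sumrMnr.
  rewrite [RHS]big_mkcond /=.
  apply: eq_bigr => j _.
  rewrite -(mxtrace_gring_op (irr_rep j)) mxtrace_Wedderburn_id.
  by case: eqP.
have := cnt U s sE; rewrite mxtrace_gring_op.
under eq_bigr => k _ do rewrite eqUV ?enum_valP //.
rewrite -mxtrace_gring_op (cnt V t tE) => /eqP.
have i0 : (0 < irr_degree i)%N := irr_degree_gt0 i.
have natF_inj m p : m%:R = p%:R :> F -> m = p.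
  wlog le_mp : m p / (m <= p)%N.
    by move=> th e; case/orP: (leq_total m p) => /th; [apply | move=> ->].
  move/eqP; rewrite eq_sym -subr_eq0 -natrB // => e0.
  apply/eqP; rewrite eqn_leq le_mp -subn_eq0; case: posnP => // gt0.
  by have [q] := natf0_pchar gt0 e0; rewrite F0.
rewrite -!mulrnA => /eqP/natF_inj/eqP; rewrite !(mulnC (irr_degree i)).
by rewrite eqn_pmul2r // => /eqP.
Qed.

End CharacterDeterminesClass.

(** * Virtual characters *)

Section VirtualCharacters.

Variables (F : fieldType) (gT : finGroupType) (G : {group gT}).
Local Notation repr := (representation F G).

(** Pairs a difference of classes of actual representations with its character.
Being a relation, it needs no proof that the character descends to the ring. *)
Definition virtual_char (x : rep_ring F G) (f : gT -> F) :=
  exists U V : repr, x = rep_class U - rep_class V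
    /\ {in G, forall g, f g = \tr (U g) - \tr (V g)}.

Lemma virtual_char_rep (U : repr) : virtual_char (rep_class U) (fun g => \tr (U g)).
Proof.
exists U, (@grepr0 F gT G); split=> [|g Gg].
  by rewrite (rep_class_degree0 (U := @grepr0 F gT G)) // subr0.
by rewrite [X in _ - X]big1 ?subr0 // => -[].
Qed.

Lemma virtual_char_opp x f :
  virtual_char x f -> virtual_char (- x) (fun g => - f g).
Proof.
case=> U [V [-> fE]]; exists V, U; split=> [|g Gg]; first by rewrite opprB.
by rewrite fE // opprB.
Qed.

Lemma virtual_char_add x y f h : virtual_char x f -> virtual_char y h ->
  virtual_char (x + y) (fun g => f g + h g).
Proof.
case=> U [V [-> fE]] [U' [V' [-> hE]]].
exists (dadd_grepr U U'), (dadd_grepr V V'); split=> [|g Gg].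
  by rewrite !rep_class_dsum opprD addrACA.
by rewrite fE // hE //= !mxtrace_block opprD addrACA.
Qed.

Lemma virtual_char_mul x y f h : virtual_char x f -> virtual_char y h ->
  virtual_char (x * y) (fun g => f g * h g).
Proof.
case=> U [V [-> fE]] [U' [V' [-> hE]]].
pose T (A B : repr) : repr := Representation (prod_repr A B).
exists (dadd_grepr (T U U') (T V V')), (dadd_grepr (T U V') (T V U')).
split=> [|g Gg].
  rewrite !rep_class_dsum !rep_class_tensor mulrBl !mulrBr opprB opprD.
  by rewrite addrACA.
rewrite fE // hE //= !mxtrace_block /= !mxtrace_prod.
by rewrite mulrBl !mulrBr opprB opprD addrACA.
Qed.

Lemma virtual_char1 : virtual_char 1 (fun _ => 1).
Proof.
have := virtual_char_rep (triv_repr F G); rewrite rep_class_triv.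
by case=> U [V [e fE]]; exists U, V; split=> // g Gg; rewrite -fE //= mxtrace1.
Qed.

Lemma virtual_char_ext x f h :
  {in G, f =1 h} -> virtual_char x f -> virtual_char x h.
Proof. by move=> fh [U [V [-> e]]]; exists U, V; split=> // g Gg; rewrite -fh ?e. Qed.

Lemma virtual_char_nat n : virtual_char n%:R (fun _ => n%:R).
Proof.
elim: n => [|n IH].
  apply: (@virtual_char_ext _ (fun _ => 1 - 1)) => [g _|]; first exact: subrr.
  rewrite mulr0n -(subrr (1 : rep_ring F G)).
  by apply/virtual_char_add/virtual_char_opp; apply: virtual_char1.
apply: (@virtual_char_ext _ (fun _ => n%:R + 1)) => [g _|]; first by rewrite natr1.
by rewrite -natr1; apply: virtual_char_add IH virtual_char1.
Qed.

Lemma virtual_char_int (k : int) : virtual_char k%:~R (fun _ => k%:~R).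
Proof.
case: k => n; first exact: virtual_char_nat.
exact: virtual_char_opp (virtual_char_nat n.+1).
Qed.

Definition eval2 (A : comNzRingType) (P : {poly {poly int}}) (s t : A) : A :=
  (map_poly (map_poly intr) P).[s%:P].[t].

(** The right-hand polynomial is spelled out rather than folded, so that it matches
the evaluation used to define sieving syntactically. *)
Lemma virtual_char_eval2 (P : {poly {poly int}}) x y f h :
    virtual_char x f -> virtual_char y h ->
  virtual_char (map_poly (map_poly intr) P).[x%:P].[y] (fun g => eval2 P (f g) (h g)).
Proof.
move=> xf yh; rewrite /eval2; elim/poly_ind: P => [|P p IH].
  rewrite rmorph0 !horner0; apply: virtual_char_ext (virtual_char_nat 0) => g _.
  by rewrite [map_poly _ 0]rmorph0 !horner0.
pose q (A : comNzRingType) (a : A) := (map_poly intr p).[a].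
have qv : virtual_char (q _ y) (fun g => q _ (h g)).
  rewrite /q; elim/poly_ind: p {q} => [|p c IHp].
    rewrite rmorph0 !horner0; apply: virtual_char_ext (virtual_char_nat 0) => g _.
    by rewrite [map_poly _ 0]rmorph0 !horner0.
  rewrite rmorphD rmorphM /= map_polyX map_polyC !hornerE.
  apply: virtual_char_ext (virtual_char_add (virtual_char_mul IHp yh)
    (virtual_char_int c)) => g _.
  by rewrite rmorphD rmorphM /= map_polyX map_polyC !hornerE.
rewrite rmorphD rmorphM /= map_polyX map_polyC hornerMXaddC hornerD hornerM hornerC.
apply: virtual_char_ext (virtual_char_add (virtual_char_mul IH xf) qv) => g _.
by rewrite rmorphD rmorphM /= map_polyX map_polyC hornerMXaddC hornerD hornerM hornerC.
Qed.

End VirtualCharacters.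

(** An identity of characters between a representation and a virtual one becomes an
identity of two actual representations after moving the negative part across. *)
Lemma rep_class_virtual_char (F : closedFieldType) (gT : finGroupType)
    (G : {group gT}) (U : representation F G) x f : [pchar F] =i pred0 ->
  virtual_char x f -> {in G, forall g, \tr (U g) = f g} -> rep_class U = x.
Proof.
move=> F0 [V [W [-> fE]]] Uf; apply/eqP; rewrite eq_sym subr_eq eq_sym.
rewrite -rep_class_dsum; apply/eqP/rep_class_trace => // g Gg.
by rewrite /= mxtrace_block Uf // fE // subrK.
Qed.

Lemma mxtrace_perm_repr (F : fieldType) (gT : finGroupType) (X : finType)
    (to : {action gT &-> X}) (g : gT) :
  \tr (perm_repr F to g) = #|[set x | to x g == x]|%:R.
Proof.
rewrite /mxtrace /= (reindex_onto enum_rank enum_val) => [|i _]; last exact: enum_valK.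
under eq_bigl do rewrite enum_rankK eqxx.
under eq_bigr do rewrite mxE enum_rankK.
by rewrite -sum1_card natr_sum [RHS]big_mkcond; apply: eq_bigr => x _;
  rewrite inE; case: eqP.
Qed.

(** The character of a permutation representation counts fixed points, so sieving
amounts to one numerical identity for each group element. *)
Lemma dihedral_sieving_fixed (R : realType) (n : nat) (X : finType)
    (to : {action dihedral n &-> X}) (P : {poly {poly int}}) :
    (forall g, #|[set x | to x g == x]|%:R
       = eval2 P (\tr (z1_mx R g)) (- (-1) ^+ dih_refl g)) ->
  dihedral_sieving R to P.
Proof.
move=> fixE; rewrite /dihedral_sieving.
pose f g := eval2 P (\tr (z1_repr R n g)) (- \tr (Defs.det_repr R n g)).
have F0 : [pchar R[i]] =i pred0 by apply: pchar_num.
have z1f := @virtual_char_rep R[i] _ _ (z1_repr R n).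
have detf := virtual_char_opp (@virtual_char_rep R[i] _ _ (Defs.det_repr R n)).
have Pf := virtual_char_eval2 P z1f detf.
apply: (rep_class_virtual_char F0 Pf).
by move=> g _; rewrite mxtrace_perm_repr fixE /f /= /det_mx mxtrace_scalar mulr1n.
Qed.

(** * Exact values of the Fibonomial Catalan numbers *)

(** The quotient of [fibpoly (j * d)] by [fibpoly d], given by the recursion that the
addition formula for [fibpoly] forces on it. *)
Fixpoint fibquot (d j : nat) : {poly {poly int}} :=
  if j is j'.+1 then fibpoly (j' * d).+1 + var_t * fibpoly d.-1 * fibquot d j'
  else 0.

Lemma fibpoly_quot d j : (0 < d)%N -> fibpoly (j * d) = fibpoly d * fibquot d j.
Proof.
case: d => // d _; elim: j => [|j IH]; first by rewrite mul0n fibpoly0 mulr0.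
rewrite /= mulSn addSn addnC fibpolyD IH; ring.
Qed.

Definition fibquotfact d k := \prod_(1 <= j < k.+1) fibquot d j.

(** The part of [fibfact N] that stays nonzero at the evaluation points of interest,
where the Fibonacci polynomials vanish exactly at the multiples of d. *)
Definition fibcofact d N := \prod_(1 <= i < N.+1 | ~~ (d %| i)%N) fibpoly i.

(** Isolating the powers of [fibpoly d] is what makes evaluation possible: at the
points of interest [fibpoly d] vanishes, and these powers must be cancelled as
polynomials before substituting. *)
Lemma fibfact_quot d N : (0 < d)%N ->
  fibfact N = fibpoly d ^+ (N %/ d) * fibquotfact d (N %/ d) * fibcofact d N.
Proof.
move=> d_gt0; elim: N => [|N IH].
  by rewrite fibfact0 div0n expr0 /fibquotfact /fibcofact !big_geq // !mulr1.
rewrite fibfactS {}IH /fibcofact big_mkcond [in RHS]big_mkcond /=.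
rewrite [in RHS]big_nat_recr //= divnS //.
have [/dvdnP[j eN]|_] := boolP (d %| N.+1)%N; last first.
  by rewrite add0n /=; ring.
rewrite [in RHS]/fibquotfact [in RHS]big_nat_recr //= -/(fibquotfact _ _).
have -> : fibpoly N.+1 = fibpoly d * fibquot d (N %/ d).+1.
  by rewrite -fibpoly_quot //; congr fibpoly; rewrite -[RHS](mulnC d);
    have := divnS N d_gt0; rewrite eN mulnK // dvdn_mull // => ->; rewrite mulnC.
by rewrite add1n exprS /=; ring.
Qed.

Lemma fibcatalan_fact n :
  fibcatalan n * fibpoly n.+1 * fibfact n ^+ 2 = fibfact n.*2.
Proof.
rewrite fibcatalan_exact -[RHS](@fibonomial_exact n.*2 n) -addnn ?leq_addr //.
by rewrite addnK expr2.
Qed.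

Section Evaluation.

Variables (K : numDomainType) (ev : {rmorphism {poly {poly int}} -> K}).
Let u m := ev (fibpoly m).

Lemma ev_fibpolySS m : u m.+2 = ev var_s * u m.+1 + ev var_t * u m.
Proof. by rewrite /u fibpolySS rmorphD !rmorphM. Qed.

Lemma ev_fibfact_nat n : (forall m, u m = m%:R) -> ev (fibfact n) = n`!%:R.
Proof.
move=> uE; elim: n => [|n IH]; first by rewrite fibfact0 rmorph1.
by rewrite fibfactS rmorphM /= IH [ev _]uE -natrM mulnC.
Qed.

Lemma ev_fibcatalan_nat n : (forall m, u m = m%:R) ->
  ev (fibcatalan n) *+ n.+1 = 'C(n.*2, n)%:R.
Proof.
move=> uE; have := congr1 ev (fibcatalan_fact n).
rewrite !rmorphM /= !ev_fibfact_nat // [ev (fibpoly _)]uE => e.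
apply: (mulIf (x := (n`! * n`!)%:R)).
  by rewrite pnatr_eq0 -lt0n muln_gt0 fact_gt0.
rewrite -mulr_natr [in LHS]natrM -expr2 [LHS]e -natrM.
by have /= := @bin_fact n.*2 n; rewrite -addnn addnK leq_addr => ->.
Qed.

Section Period.
Variable d : nat.
Hypotheses (d_gt0 : (0 < d)%N) (ud : u d = 0) (ud1 : u d.+1 = 1).

(** The sequence satisfies a linear recursion of order two and its terms at d and
d + 1 agree with those at 0 and 1. *)
Lemma ev_fibpoly_period i : u (i + d) = u i.
Proof.
suff : u (i + d) = u i /\ u (i.+1 + d) = u i.+1 by case.
elim: i => [|i [IH1 IH2]].
  by rewrite !add1n ud ud1 /u fibpoly0 fibpoly1 rmorph0 rmorph1.
by split=> //; rewrite !addSn !ev_fibpolySS -addSn IH2 IH1.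
Qed.

Lemma ev_fibpoly_periodM i j : u (i + j * d) = u i.
Proof.
by elim: j => [|j IH]; rewrite ?addn0 // mulSn addnCA addnC ev_fibpoly_period.
Qed.

Lemma ev_fibquot j : ev (fibquot d j) = j%:R.
Proof.
elim: j => [|j IH] /=; first by rewrite rmorph0.
rewrite rmorphD !rmorphM IH /=.
have -> : ev var_t * ev (fibpoly d.-1) = 1.
  have := ev_fibpolySS d.-1; rewrite prednK // ud ud1.
  by rewrite mulr0 add0r => ->.
have := ev_fibpoly_periodM 1 j; rewrite add1n /u => ->.
by rewrite fibpoly1 rmorph1 mul1r -natr1 addrC.
Qed.

Lemma ev_fibquotfact k : ev (fibquotfact d k) = k`!%:R.
Proof.
elim: k => [|k IH]; first by rewrite /fibquotfact big_geq // rmorph1.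
rewrite /fibquotfact big_nat_recr // rmorphM ev_fibquot.
by rewrite -/(fibquotfact d k) [ev _]IH -natrM mulnC.
Qed.

Lemma ev_fibcofact_neq0 N : (forall i, (0 < i < d)%N -> u i != 0) ->
  ev (fibcofact d N) != 0.
Proof.
move=> u_neq0; rewrite rmorph_prod prodf_seq_neq0; apply/allP => i _.
apply/implyP => di; have := ev_fibpoly_periodM (i %% d) (i %/ d).
rewrite addnC -divn_eq /u => ->; apply: u_neq0.
by rewrite ltn_mod d_gt0 andbT lt0n.
Qed.

(** Both sides of the factorial identity carry the factor [fibpoly d] to the power
2m. After cancelling it, the factors whose index is not a multiple of d repeat from
the first half of the range to the second by periodicity, so they cancel too. What
remains are the quotients, which contribute factorials. *)
Lemma ev_fibcatalan_rot m : (forall i, (0 < i < d)%N -> u i != 0) ->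
  ev (fibcatalan (m * d)) = 'C(m.*2, m)%:R.
Proof.
move=> u_neq0; have := fibcatalan_fact (m * d).
have e2 : ((m * d).*2 = m.*2 * d)%N by rewrite doubleMl.
rewrite e2 !(@fibfact_quot d _ d_gt0) !mulnK // -[in fibcofact _ (_.*2 * _)]e2.
set c := fibcatalan _ => e.
have : c * fibpoly (m * d).+1 * (fibquotfact d m * fibcofact d (m * d)) ^+ 2
    = fibquotfact d m.*2 * fibcofact d (m * d).*2.
  apply: (mulfI (x := fibpoly d ^+ m.*2)).
    by rewrite expf_neq0 // -(prednK d_gt0) monic_neq0 // fibpoly_monic.
  rewrite [RHS]mulrA -e -addnn exprD; ring.
move/(congr1 ev); rewrite !(rmorphM, rmorphXn) /= !ev_fibquotfact.
have -> : ev (fibpoly (m * d).+1) = 1.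
  by have := ev_fibpoly_periodM 1 m; rewrite add1n /u => ->; rewrite fibpoly1 rmorph1.
have -> : ev (fibcofact d (m * d).*2) = ev (fibcofact d (m * d)) ^+ 2.
  rewrite /fibcofact (big_cat_nat (n := (m * d).+1)) //=; last by rewrite ltnS -addnn leq_addr.
  rewrite rmorphM expr2; congr (_ * _); rewrite -addnn -addnS.
  rewrite -[X in \prod_(X <= _ < _ | _) _]add1n big_addn addKn.
  rewrite !rmorph_prod; apply: eq_big => [i|i _].
    by rewrite dvdn_addl // dvdn_mull.
  exact: ev_fibpoly_periodM.
rewrite mulr1 mulrACA [LHS]mulrA expr2 => /mulIf.
rewrite mulf_neq0 ?ev_fibcofact_neq0 // => /(_ isT) {}e; apply: (mulIf (x := (m`! * m`!)%:R)).
  by rewrite pnatr_eq0 -lt0n muln_gt0 fact_gt0.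
rewrite [in LHS]natrM e -natrM.
by have /= := @bin_fact m.*2 m; rewrite -addnn addnK leq_addr => ->.
Qed.

End Period.

(** Here d = 2 does not divide the odd index, but it divides the successor, and
the factor [fibpoly (n + 1)] supplies the missing power of [fibpoly 2]. *)
Lemma ev_fibcatalan_refl p : ev var_s = 0 -> ev var_t = 1 ->
  ev (fibcatalan p.*2.+1) = 'C(p.*2.+1, p)%:R.
Proof.
move=> s0 t1.
have u2 : u 2 = 0 by rewrite ev_fibpolySS s0 t1 /u fibpoly0 rmorph0 mul0r mulr0 addr0.
have u3 : u 3 = 1 by rewrite ev_fibpolySS s0 t1 /u fibpoly1 rmorph1 mul0r mulr1 add0r.
have prime1 N : ev (fibcofact 2 N) = 1.
  rewrite rmorph_prod big1 // => i; rewrite dvdn2 negbK => odd_i.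
  rewrite -(odd_double_half i) odd_i -muln2.
  by have := ev_fibpoly_periodM u2 u3 1 i./2; rewrite /u => ->; rewrite fibpoly1 rmorph1.
set n := p.*2.+1; have := fibcatalan_fact n.
have e1 : (n %/ 2 = p)%N by rewrite divn2 /n /= uphalf_double.
have e2 : (n.*2 %/ 2 = n)%N by rewrite divn2 doubleK.
have e3 : (n.+1 = p.+1 * 2)%N by rewrite muln2 doubleS.
rewrite !(@fibfact_quot 2) // e1 e2 e3 fibpoly_quot //; set c := fibcatalan _ => e.
have : c * fibquot 2 p.+1 * (fibquotfact 2 p * fibcofact 2 n) ^+ 2
    = fibquotfact 2 n * fibcofact 2 n.*2.
  apply: (mulfI (x := fibpoly 2 ^+ n)).
    by rewrite expf_neq0 // monic_neq0 // fibpoly_monic.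
  rewrite [RHS]mulrA -e /n exprS -addnn exprD; ring.
move/(congr1 ev); rewrite !(rmorphM, rmorphXn) !ev_fibquotfact // ev_fibquot //.
rewrite !prime1 !mulr1 => {}e; apply: (mulIf (x := (p`! * p.+1`!)%:R)).
  by rewrite pnatr_eq0 -lt0n muln_gt0 !fact_gt0.
transitivity (n`!%:R : K); first by rewrite -e factS !natrM; ring.
rewrite -natrM; have /= := @bin_fact n p.
have -> : (n - p = p.+1)%N by rewrite /n -addnn -addnS addKn.
by move=> -> //; rewrite /n -addnn -addnS leq_addr.
Qed.

End Evaluation.

(** * The character of the polynomial at each dihedral element *)

Lemma eval2_rmorph (A : comNzRingType) (s t : A) :
  {ev : {rmorphism {poly {poly int}} -> A} | forall P, ev P = eval2 P s t}.
Proof.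
by exists (horner_eval t \o horner_eval s%:P \o map_poly (map_poly intr)).
Qed.

Lemma eval2_s (A : comNzRingType) (s t : A) : eval2 var_s s t = s.
Proof. by rewrite /eval2 map_polyX hornerX hornerC. Qed.

Lemma eval2_t (A : comNzRingType) (s t : A) : eval2 var_t s t = t.
Proof. by rewrite /eval2 map_polyC hornerC /= map_polyX hornerX. Qed.

Section Trig.
Variables (R : realType).

Lemma mxtrace_rotation_mx (x : R) : \tr (rotation_mx x) = (cos x *+ 2)%:C.
Proof.
by rewrite /mxtrace !big_ord_recr big_ord0 /= !mxE /= add0r -rmorphD mulr2n.
Qed.

Lemma mxtrace_z1_refl n (i : 'Z_n) : \tr (z1_mx R (Dih i true)) = 0.
Proof.
rewrite /mxtrace !big_ord_recr big_ord0 /= !mxE !big_ord_recr !big_ord0 /= !mxE /=.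
by rewrite !(mulr0, mulr1, add0r, addr0, mulrN1) subrr.
Qed.

Lemma mxtrace_z1_rot n (i : 'Z_n) :
  \tr (z1_mx R (Dih i false)) = (cos (pi *+ 2 / n%:R *+ i) *+ 2)%:C.
Proof. by rewrite /z1_mx /= mulmx1 mxtrace_rotation_mx. Qed.

Lemma sin_natmul_pi_neq0 (n k : nat) : (0 < n)%N -> ~~ (n %| k)%N ->
  sin (pi / n%:R *+ k : R) != 0.
Proof.
move=> n_gt0 nk; have n0 : n%:R != 0 :> R by rewrite pnatr_eq0 -lt0n.
rewrite (divn_eq k n) mulrnDr mulnC mulrnA.
rewrite -[_ *+ n]mulr_natr divfK // addrC.
elim: (k %/ n)%N => [|q IH].
  rewrite mulr0n addr0 lt0r_neq0 // sin_gt0_pi //.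
    have r_gt0 : (0 < k %% n)%N by rewrite lt0n.
    have pin : 0 < pi / n%:R :> R by rewrite divr_gt0 ?pi_gt0 ?ltr0n.
    rewrite pmulrn_lgt0 // pin /= -[X in _ < X](divfK n0) mulr_natr.
    by rewrite ltr_pMn2l ?ltn_mod.
by rewrite mulrSr addrA sinDpi oppr_eq0.
Qed.

Section Rotation.
Variables (x : R) (ev : {rmorphism {poly {poly int}} -> R[i]}).
Hypotheses (ev_s : ev var_s = (cos x *+ 2)%:C) (ev_t : ev var_t = -1).

(** With s = 2 cos x and t = -1 the Fibonacci recursion is the one satisfied by
sin (m x). *)
Lemma ev_fibpoly_sin m : ev (fibpoly m) * (sin x)%:C = (sin (x *+ m))%:C.
Proof.
suff : ev (fibpoly m) * (sin x)%:C = (sin (x *+ m))%:C /\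
  ev (fibpoly m.+1) * (sin x)%:C = (sin (x *+ m.+1))%:C by case.
elim: m => [|m [IH1 IH2]].
  by rewrite fibpoly0 fibpoly1 rmorph0 rmorph1 mul0r mul1r mulr0n sin0.
split=> //; rewrite fibpolySS rmorphD !rmorphM ev_s ev_t.
rewrite mulrDl -!mulrA IH2 IH1 mulN1r -rmorphM -rmorphB /=; congr _%:C.
have -> : x *+ m = x *+ m.+1 - x by rewrite mulrSr addrK.
have -> : x *+ m.+2 = x *+ m.+1 + x by rewrite -mulrSr.
by rewrite sinB sinD mulr2n; ring.
Qed.

End Rotation.

Variables (n : nat) (n_ge3 : (3 <= n)%N) (n_odd : odd n).
Let n_gt0 : (0 < n)%N. Proof. by apply: leq_trans n_ge3. Qed.

Definition fibcatalan_value (g : dihedral n) : R[i] :=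
  eval2 (fibcatalan n) (\tr (z1_mx R g)) (- (-1) ^+ dih_refl g).

Lemma fibcatalan_value_one :
  fibcatalan_value (Dih 0 false) *+ n.+1 = 'C(n.*2, n)%:R.
Proof.
rewrite /fibcatalan_value mxtrace_z1_rot /= mulr0n cos0 expr0.
have [ev evE] := eval2_rmorph (1 *+ 2)%:C (-1 : R[i]); rewrite -evE.
apply: ev_fibcatalan_nat => m.
suff : ev (fibpoly m) = m%:R /\ ev (fibpoly m.+1) = m.+1%:R by case.
elim: m => [|m [IH1 IH2]]; first by rewrite fibpoly0 fibpoly1 rmorph0 rmorph1.
split=> //; rewrite fibpolySS rmorphD !rmorphM !evE eval2_s eval2_t -!evE IH1 IH2.
rewrite rmorphMn rmorph1 /= -[m.+2]addn2 -[m.+1]addn1 !natrD; ring.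
Qed.

Lemma fibcatalan_value_refl (i : 'Z_n) :
  fibcatalan_value (Dih i true) = 'C(n, n./2)%:R.
Proof.
rewrite /fibcatalan_value mxtrace_z1_refl /= expr1 opprK.
have [ev evE] := eval2_rmorph 0 (1 : R[i]); rewrite -evE.
have nE : n = n./2.*2.+1 by rewrite -[LHS]odd_double_half n_odd.
rewrite [in LHS]nE ev_fibcatalan_refl; first by rewrite -nE.
  by rewrite evE eval2_s.
by rewrite evE eval2_t.
Qed.

(** For the rotation by i steps, x = 2 pi i / n and [fibpoly j] vanishes exactly when
n divides i j, that is when the order d of the rotation divides j. Oddness of n
is used to pass from 2 i j to i j. *)
Lemma fibcatalan_value_cos i : (0 < i < n)%N ->
  eval2 (fibcatalan n) (cos (pi *+ 2 / n%:R *+ i) *+ 2)%:C (-1)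
    = 'C((gcdn i n).*2, gcdn i n)%:R :> R[i].
Proof.
case/andP=> i_gt0 i_ltn.
set x := _ *+ i; set m := gcdn i n.
have [ev evE] := eval2_rmorph (cos x *+ 2)%:C (-1 : R[i]); rewrite -evE.
have ev_s : ev var_s = (cos x *+ 2)%:C by rewrite evE eval2_s.
have ev_t : ev var_t = -1 by rewrite evE eval2_t.
have sinE := ev_fibpoly_sin ev_s ev_t.
have xk k : x *+ k = pi / n%:R *+ (2 * (i * k)).
  by rewrite /x mulrnAl -!mulrnA mulnA.
have sin_neq0 k : ~~ (n %| i * k)%N -> sin (x *+ k) != 0.
  move=> nik; rewrite xk sin_natmul_pi_neq0 // Gauss_dvdr //.
  by rewrite coprimen2.
have sinx : (sin x)%:C != 0.
  have := sin_neq0 1%N; rewrite muln1 mulr1n gtnNdvd // => /(_ isT).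
  by apply: contra_neq => /complexI.
have m_gt0 : (0 < m)%N by rewrite gcdn_gt0 n_gt0 orbT.
pose d := (n %/ m)%N.
have nE : n = (m * d)%N by rewrite mulnC divnK // dvdn_gcdr.
have d_gt0 : (0 < d)%N by have := n_gt0; rewrite nE muln_gt0 => /andP[].
have iE : i = ((i %/ m) * m)%N :> nat by rewrite divnK // dvdn_gcdl.
have cop : coprime d (i %/ m).
  rewrite /coprime -(eqn_pmul2r m_gt0) muln_gcdl -iE -[(d * m)%N]mulnC -nE mul1n.
  by rewrite gcdnC.
have dE k : (n %| i * k)%N = (d %| k)%N.
  by rewrite nE iE -mulnA mulnCA dvdn_pmul2l // Gauss_dvdr.
have [xd_sin xd_cos] : sin (x *+ d) = 0 /\ cos (x *+ d) = 1.
  have := dE d; rewrite dvdnn => /dvdnP[q qE].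
  have -> : x *+ d = 0 + pi *+ 2 *+ q.
    rewrite xk qE mulnA mulnC mulnA [RHS]add0r mulrnA mulrnA -[_ *+ n]mulr_natr.
    by rewrite divfK ?pnatr_eq0 -?lt0n // -!mulrnA mulnC.
  by rewrite (periodicn (@sinD2pi R)) (periodicn (@cosD2pi R)) sin0 cos0.
rewrite {1}nE; apply: ev_fibcatalan_rot => //.
- by apply: (mulIf sinx); rewrite sinE mul0r xd_sin.
- by apply: (mulIf sinx); rewrite sinE mul1r mulrSr sinD xd_sin xd_cos mul0r mul1r add0r.
move=> j /andP[j_gt0 lt_jd]; apply: contraTneq (isT) => uj.
have := sin_neq0 j; rewrite dE gtnNdvd // => /(_ isT) /eqP; case.
by apply: (@complexI R); rewrite -sinE uj mul0r.
Qed.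

Lemma fibcatalan_value_rot (i : 'Z_n) : i != 0 ->
  fibcatalan_value (Dih i false) = 'C((gcdn i n).*2, gcdn i n)%:R.
Proof.
move=> i0; rewrite /fibcatalan_value mxtrace_z1_rot /= expr0 fibcatalan_value_cos //.
by have := ltn_ord i; rewrite {2}Zp_cast ?(ltnW n_ge3) // lt0n i0.
Qed.
End Trig.

(** * Lattice words *)

Definition step (b : bool) : int := if b then 1 else -1.
Definition height (s : seq bool) (k : nat) : int := \sum_(i < k) step (nth false s i).

Lemma height_cons b s k : height (b :: s) k.+1 = step b + height s k.
Proof. by rewrite /height big_ord_recl. Qed.

Lemma heightS s k : height s k.+1 = height s k + step (nth false s k).
Proof. by rewrite /height big_ord_recr. Qed.

Lemma height0 s : height s 0 = 0.
Proof. by rewrite /height big_ord0. Qed.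

Fixpoint nonneg_from (h : nat) (s : seq bool) : bool :=
  match s with
  | [::] => true
  | true :: s' => nonneg_from h.+1 s'
  | false :: s' => if h is h'.+1 then nonneg_from h' s' else false
  end.

Lemma nonneg_fromP h s :
  reflect (forall k, (k <= size s)%N -> 0 <= h%:Z + height s k) (nonneg_from h s).
Proof.
elim: s h => [|b s IH] h; first by constructor=> -[]//; rewrite height0 addr0.
have cons h' : h'%:Z = h%:Z + step b ->
    (forall k, (k <= size s)%N -> 0 <= h'%:Z + height s k) <->
    (forall k, (k <= size (b :: s))%N -> 0 <= h%:Z + height (b :: s) k).
  move=> hE; split=> pos k le_k.
    case: k le_k => [|k] le_k; first by rewrite height0; lia.
    by rewrite height_cons addrA -hE pos.
  by rewrite hE -addrA -height_cons pos.
case: b cons => cons /=.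
  have hE : h.+1%:Z = h%:Z + step true by rewrite /step; lia.
  exact: (iffP (IH _) (cons _ hE).1 (cons _ hE).2).
case: h cons => [|h] cons.
  by constructor=> /(_ 1%N isT); rewrite height_cons height0.
have hE : h%:Z = h.+1%:Z + step false by rewrite /step; lia.
exact: (iffP (IH _) (cons _ hE).1 (cons _ hE).2).
Qed.

Lemma height_size s : height s (size s) = ((count id s).*2)%:Z - (size s)%:Z.
Proof.
elim: s => [|b s IH]; first by rewrite height0.
rewrite height_cons IH; case: b => /=; rewrite /step; lia.
Qed.

Definition word_sum N (t : N.-tuple bool) : int := height t N.

Lemma word_sumE N (t : N.-tuple bool) : word_sum t = ((count id t).*2)%:Z - N%:Z.
Proof. by rewrite /word_sum; have := height_size t; rewrite size_tuple. Qed.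

Lemma word_sum_cons N b (t : N.-tuple bool) : word_sum [tuple of b :: t] = step b + word_sum t.
Proof. exact: height_cons. Qed.

Lemma sum_tuple_cons N (f : N.+1.-tuple bool -> nat) :
  \sum_t f t = (\sum_(t : N.-tuple bool) f [tuple of true :: t]
             + \sum_(t : N.-tuple bool) f [tuple of false :: t])%N.
Proof.
rewrite -big_split /=.
transitivity (\sum_(t : N.-tuple bool) \sum_(b : bool) f [tuple of b :: t])%N.
  rewrite pair_bigA /=.
  rewrite (reindex (fun p : N.-tuple bool * bool => [tuple of p.2 :: p.1])) //=.
  exists (fun t : N.+1.-tuple bool => ([tuple of behead t], thead t)) => [[t b] _|t _] /=.
    by congr (_, _); apply: val_inj.
  by rewrite -tuple_eta.
by apply: eq_bigr => t _; rewrite big_bool.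
Qed.

Lemma sum_tuple0 (f : 0.-tuple bool -> nat) : (\sum_t f t = f [tuple])%N.
Proof.
rewrite (bigD1 [tuple]) //= big1 ?addn0 // => t /negP[].
exact/eqP/tuple0.
Qed.

Lemma card_count_true N k :
  (\sum_(t : N.-tuple bool) (count id t == k) = 'C(N, k))%N.
Proof.
elim: N k => [|N IH] k; first by rewrite sum_tuple0 /= bin0n eq_sym; case: eqP.
rewrite sum_tuple_cons /=; under [X in (_ + X)%N]eq_bigr do rewrite add0n.
rewrite IH; case: k => [|k]; last by rewrite IH binS addnC.
by rewrite big1 // !bin0.
Qed.

Definition card_word_sum N (s : int) := (\sum_(t : N.-tuple bool) (word_sum t == s))%N.

Lemma card_word_sumE N k : card_word_sum N ((k.*2)%:Z - N%:Z) = 'C(N, k).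
Proof.
by rewrite -card_count_true; apply: eq_bigr => t _; rewrite word_sumE; congr nat_of_bool;
  lia.
Qed.

Lemma card_word_sumS N s :
  card_word_sum N.+1 s = (card_word_sum N (s - 1)%R + card_word_sum N (s + 1)%R)%N.
Proof.
rewrite /card_word_sum sum_tuple_cons; congr (_ + _)%N; apply: eq_bigr => t _;
  rewrite word_sum_cons /step; congr nat_of_bool; lia.
Qed.

Lemma card_word_sumN N s : card_word_sum N (- s) = card_word_sum N s.
Proof.
elim: N s => [|N IH] s.
  by rewrite /card_word_sum !sum_tuple0 /word_sum !height0; congr nat_of_bool; lia.
rewrite !card_word_sumS addnC -[RHS](congr2 addn (IH _) (IH _)).
by congr (card_word_sum N _ + card_word_sum N _)%N; lia.
Qed.

(** The ballot count, by induction on the length: both the number of nonnegative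
words and the difference of two level counts satisfy the same one-step recursion,
and at height 0 the missing branch is compensated by the symmetry of the level
counts. *)
Lemma card_dyck_from N h :
  (\sum_(t : N.-tuple bool) (nonneg_from h t && (word_sum t == - h%:Z)%R)
     + card_word_sum N (- h%:Z - 2)%R = card_word_sum N (- h%:Z)%R)%N.
Proof.
elim: N h => [|N IH] h.
  by rewrite /card_word_sum !sum_tuple0 /= /word_sum !height0; lia.
rewrite sum_tuple_cons !card_word_sumS.
have := IH h.+1; set A := bigop _ _ _ => eA.
rewrite (_ : bigop _ _ _ = A); last first.
  by apply: eq_bigr => t _; rewrite word_sum_cons /=; congr (nat_of_bool (_ && _));
    rewrite /step; lia.
have e1 : - h.+1%:Z = - h%:Z - 1 by lia.
rewrite e1 in eA; clearbody A; case: h eA e1 => [|h] eA e1.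
  rewrite big1 // addn0.
  rewrite (_ : - 0%N%:Z - 2 - 1 = - 0%N%:Z - 1 - 2); last by lia.
  rewrite (_ : - 0%N%:Z - 2 + 1 = - 0%N%:Z - 1); last by lia.
  by rewrite addnA eA; congr (_ + _)%N; rewrite -card_word_sumN; congr card_word_sum; lia.
have := IH h; set B := bigop _ _ _ => eB.
rewrite (_ : bigop _ _ _ = B); last first.
  by apply: eq_bigr => t _; rewrite word_sum_cons /=; congr (nat_of_bool (_ && _));
    rewrite /step; lia.
have e2 : - h.+1%:Z - 2 - 1 = - h.+1%:Z - 1 - 2 by lia.
have e3 : - h.+1%:Z - 2 + 1 = - h.+1%:Z - 1 by lia.
have e4 : - h.+1%:Z + 1 = - h%:Z by lia.
have e5 : - h%:Z - 2 = - h.+1%:Z - 1 by lia.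
by rewrite e2 e3 e4 -eB e5 addnACA eA.
Qed.

Lemma card_dyck n :
  (#|[set t : (n.*2).-tuple bool | nonneg_from 0 t & word_sum t == 0]| * n.+1
     = 'C(n.*2, n))%N.
Proof.
have := card_dyck_from n.*2 0.
set A := bigop _ _ _; have -> : #|[set t : (n.*2).-tuple bool |
    nonneg_from 0 t & word_sum t == 0]| = A.
  by rewrite -sum1dep_card big_mkcond; apply: eq_bigr => t _; rewrite oppr0; case: ifP.
rewrite (_ : - 0%N%:Z = (n.*2)%:Z - (n.*2)%:Z); last by lia.
rewrite card_word_sumE; clearbody A.
case: n A => [|n] A.
  rewrite !bin0 (_ : card_word_sum _ _ = 0%N); first by lia.
  by rewrite /card_word_sum sum_tuple0 /word_sum height0.
(* The words of sum - 2 are those with one up step less than half. *)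
rewrite (_ : _ - 2 = (n.*2)%:Z - (n.+1.*2)%:Z); last by lia.
rewrite card_word_sumE => e.
have := mul_bin_left n.+1.*2 n.
rewrite (_ : (n.+1.*2 - n)%N = n.+2); last by lia.
nia.
Qed.

Lemma card_balanced n :
  #|[set t : (n.*2).-tuple bool | word_sum t == 0]| = 'C(n.*2, n).
Proof.
rewrite -card_word_sumE subrr -sum1dep_card big_mkcond /=.
by apply: eq_bigr => t _; case: ifP.
Qed.

Definition card_between N (a b : int) :=
  (\sum_(t : N.-tuple bool) ((a <= word_sum t <= b)%R : nat))%N.

(** The same induction for words with a free endpoint; the recursion holds between
indicator functions of intervals, pointwise on words. *)
Lemma card_nonneg_from N h :
  (\sum_(t : N.-tuple bool) nonneg_from h t = card_between N (- h%:Z)%R h.+1%:Z)%N.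
Proof.
elim: N h => [|N IH] h.
  by rewrite /card_between !sum_tuple0 /= /word_sum !height0; lia.
rewrite /card_between !sum_tuple_cons /= IH; case: h => [|h].
  rewrite big1 // addn0 /card_between -big_split /=; apply: eq_bigr => t _.
  rewrite !word_sum_cons /step; lia.
rewrite IH /card_between -!big_split /=; apply: eq_bigr => t _.
rewrite !word_sum_cons /step; lia.
Qed.

Lemma card_nonneg n :
  #|[set t : n.-tuple bool | nonneg_from 0 t]| = 'C(n, n./2).
Proof.
rewrite -bin_sub; last by lia.
rewrite -card_count_true -sum1dep_card big_mkcond /=.
transitivity (\sum_(t : n.-tuple bool) nonneg_from 0 t)%N.
  by apply: eq_bigr => t _; case: ifP.
rewrite card_nonneg_from; apply: eq_bigr => t _; rewrite word_sumE; lia.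
Qed.

(** * Antisymmetric words *)

Definition flip (s : seq bool) := map negb (rev s).

Lemma size_flip s : size (flip s) = size s.
Proof. by rewrite size_map size_rev. Qed.

Lemma nth_flip s k : (k < size s)%N ->
  nth false (flip s) k = ~~ nth false s (size s - k.+1).
Proof. by move=> lt_k; rewrite (nth_map false) ?size_rev // nth_rev. Qed.

Lemma height_cat s s' k : (k <= size s)%N -> height (s ++ s') k = height s k.
Proof.
move=> le_k; apply: eq_bigr => i _; rewrite nth_cat.
by rewrite (leq_trans (ltn_ord i) le_k).
Qed.

Lemma height_cat_flip s k : (k <= size s)%N ->
  height (s ++ flip s) (size s + k) = height s (size s - k).
Proof.
elim: k => [|k IH] le_k; first by rewrite addn0 subn0 height_cat.
rewrite addnS heightS IH 1?ltnW // nth_cat ltnNge leq_addr /= addKn nth_flip //.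
have -> : (size s - k = (size s - k.+1).+1)%N by lia.
by rewrite heightS; case: nth; rewrite /step /=; lia.
Qed.

Lemma flip_split n (s : seq bool) : size s = n.*2 -> flip s = s ->
  s = take n s ++ flip (take n s).
Proof.
move=> sz pal; rewrite -[LHS](cat_take_drop n); congr (_ ++ _).
have st : size (take n s) = n by rewrite size_takel // sz -addnn leq_addr.
have : flip s = flip (drop n s) ++ flip (take n s).
  by rewrite -[in LHS](cat_take_drop n s) /flip rev_cat map_cat.
rewrite pal -[in X in X = _ -> _](cat_take_drop n s) => /eqP.
rewrite eqseq_cat; first by case/andP => _ /eqP.
by rewrite size_flip st size_drop sz -addnn addnK.
Qed.

(** A word equal to its reversed negation is determined by its first half, which may
be any nonnegative word: heights in the second half repeat those of the first
half in reverse order. *)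
Lemma card_dyck_flip n :
  #|[set t : (n.*2).-tuple bool |
      [&& nonneg_from 0 t, word_sum t == 0 & flip t == t]]| = 'C(n, n./2).
Proof.
rewrite -card_nonneg.
pose fst_half (t : (n.*2).-tuple bool) : n.-tuple bool := insubd [tuple of nseq n false] (take n t).
have fst_halfE (t : (n.*2).-tuple bool) : val (fst_half t) = take n t.
  by rewrite val_insubd size_takel ?eqxx // size_tuple -addnn leq_addr.
set A := [set t | _].
rewrite -(@card_in_imset _ _ fst_half A); last first.
  move=> t t'; rewrite !inE => /and3P[_ _ /eqP pt] /and3P[_ _ /eqP pt'] e.
  apply: val_inj; rewrite /= (flip_split (size_tuple t) pt).
  by rewrite (flip_split (size_tuple t') pt') -!fst_halfE e.
apply: eq_card => u; apply/imsetP/idP => [[t]|].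
  rewrite !inE => /and3P[/nonneg_fromP pos _ _] ->; rewrite fst_halfE.
  apply/nonneg_fromP => k; rewrite size_takel ?size_tuple -?addnn ?leq_addr // => le_k.
  rewrite -(@height_cat _ (drop n t)); last first.
    by rewrite size_takel // size_tuple -addnn leq_addr.
  by rewrite cat_take_drop; apply: pos; rewrite size_tuple -addnn (leq_trans le_k) ?leq_addr.
rewrite inE => /nonneg_fromP pos.
have sz : size (u ++ flip u) == n.*2 by rewrite size_cat size_flip size_tuple addnn.
have su := size_tuple u.
have hE k : (k <= n)%N -> height (u ++ flip u) (n + k) = height u (n - k).
  by move=> le_k; have := @height_cat_flip u k; rewrite su; apply.
exists (Tuple sz); last first.
  by apply: val_inj; rewrite fst_halfE /= take_size_cat.
rewrite inE; apply/and3P; split.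
- apply/nonneg_fromP => k; rewrite (eqP sz) /= => le_k; case: (leqP k n) => [le_kn|lt_nk].
    by rewrite height_cat ?su // pos // su.
  rewrite -(subnKC (ltnW lt_nk)) hE; last by lia.
  by apply: pos; rewrite su leq_subr.
- by rewrite /word_sum /= -addnn hE // subnn height0.
rewrite /= /flip rev_cat map_cat -!map_rev revK -map_comp.
by rewrite -[X in _ == X ++ _]map_id; apply/eqP; congr (_ ++ _); apply: eq_map => b /=; rewrite negbK.
Qed.

(** * Non-crossing equivalences on the integers *)

(** Relations on all of the integers are used, so that cyclic phenomena become
periodicity and no interval endpoint needs special treatment. *)
Definition noncrossing_equiv (r : int -> int -> Prop) : Prop :=
  [/\ forall x, r x x, forall x y, r x y -> r y x,
      forall x y z, r x y -> r y z -> r x z &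
      forall a b c d, a < b -> b < c -> c < d -> r a c -> r b d -> r a b].

Definition linked_left (r : int -> int -> Prop) x := exists2 y, y < x & r y x.
Definition linked_right (r : int -> int -> Prop) x := exists2 y, x < y & r x y.

Definition periodic (m : nat) (r : int -> int -> Prop) :=
  forall x y, r (x + m%:Z) (y + m%:Z) <-> r x y.

Definition mirror (r : int -> int -> Prop) : int -> int -> Prop :=
  fun x y => r (-1 - x) (-1 - y).

Lemma mirror_noncrossing r : noncrossing_equiv r -> noncrossing_equiv (mirror r).
Proof.
case=> refl sym trans nc; split=> [x|x y|x y z|a b c d ab bc cd ac bd];
  rewrite /mirror.
- exact: refl.
- exact: sym.
- exact: trans.
have := nc (-1 - d) (-1 - c) (-1 - b) (-1 - a); rewrite !ltrD2l !ltrN2.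
move=> /(_ cd bc ab (sym _ _ bd) (sym _ _ ac)) dc.
apply: (trans _ (-1 - c)) => //; apply: (trans _ (-1 - d)); last exact: sym.
exact: sym.
Qed.

Lemma mirror_periodic m r : periodic m r -> periodic m (mirror r).
Proof.
move=> per x y; rewrite /mirror -per.
by rewrite [-1 - (x + _) + _](_ : _ = -1 - x) 1?[-1 - (y + _) + _](_ : _ = -1 - y);
  [|lia|lia].
Qed.

Lemma linked_left_mirror r x : (forall x y, r x y -> r y x) ->
  linked_left (mirror r) x <-> linked_right r (-1 - x).
Proof.
move=> sym; split=> -[y xy ry].
  by exists (-1 - y); [lia | apply: sym].
exists (-1 - y); first by lia.
by rewrite /mirror (_ : -1 - (-1 - y) = y); [apply: sym | lia].
Qed.

Lemma linked_right_mirror r x : (forall x y, r x y -> r y x) ->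
  linked_right (mirror r) x <-> linked_left r (-1 - x).
Proof.
move=> sym; split=> -[y xy ry].
  by exists (-1 - y); [lia | apply: sym].
exists (-1 - y); first by lia.
by rewrite /mirror (_ : -1 - (-1 - y) = y); [apply: sym | lia].
Qed.

Lemma nearest_right r x : linked_right r x ->
  exists y, [/\ x < y, r x y & forall z, x < z -> z < y -> ~ r x z].
Proof.
case=> y xy rxy; pose p k := `[< r x (x + k.+1%:Z) >].
have /ex_minnP[k /asboolP pk min] : exists k, p k.
  exists `|y - x|.-1%N; apply/asboolP.
  by rewrite (_ : x + _ = y) //; lia.
exists (x + k.+1%:Z); split=> //; first by lia.
move=> z xz zk rxz; have := min `|z - x|.-1%N.
have -> : p `|z - x|.-1%N by apply/asboolP; rewrite (_ : x + _ = z) //; lia.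
by move/(_ isT); lia.
Qed.

Lemma nearest_left r x : linked_left r x ->
  exists y, [/\ y < x, r y x & forall z, y < z -> z < x -> ~ r z x].
Proof.
case=> y yx ryx.
have [|z [xz rz nz]] := @nearest_right (fun a b => r (- b) (- a)) (- x).
  by exists (- y); [lia | rewrite !opprK].
exists (- z); split; [lia | by rewrite opprK in rz |].
by move=> u uz ux; have := nz (- u); rewrite !opprK; apply; lia.
Qed.

(** The induction step of the uniqueness statement: let x and y be consecutive in a
class of the first relation. In the second one x has a successor z and y has a
predecessor w. Either of them inside ]x, y[ is excluded by induction, and if both
lie outside then the arcs from w to y and from x to z cross, which joins x
to y. *)
Lemma noncrossing_incl (r1 r2 : int -> int -> Prop) (k : nat) :
    noncrossing_equiv r1 -> noncrossing_equiv r2 ->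
    (forall x, linked_left r1 x -> linked_left r2 x) ->
    (forall x, linked_right r1 x -> linked_right r2 x) ->
    (forall x (j : nat), (j < k)%N -> r1 x (x + j%:Z) <-> r2 x (x + j%:Z)) ->
  forall x, r1 x (x + k%:Z) -> r2 x (x + k%:Z).
Proof.
move=> [refl1 sym1 trans1 _] [refl2 sym2 trans2 nc2] left12 right12 IH x.
have [->|k_gt0] := posnP k; first by rewrite addr0 => _; apply: refl2.
set y := x + _ => rxy; have lt_xy : x < y by rewrite /y; lia.
have dist a b : a <= b -> b - a < k%:Z -> r1 a b <-> r2 a b.
  move=> ab lt; have -> : b = a + `|b - a|%N%:Z by lia.
  by apply: IH; lia.
have [[z [xz zy rxz]]|no_mid] :=
    pselect (exists z, [/\ x < z, z < y & r1 x z]).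
  apply: (trans2 _ z); first by apply/dist => //; lia.
  by apply/dist; [lia|lia|apply: trans1 rxy; apply: sym1].
have [|z [xz rxz nz]] := @nearest_right r2 x; first by apply: right12; exists y.
have [|w [wy rwy nw]] := @nearest_left r2 y; first by apply: left12; exists x.
have [zy|yz|<-//] := ltgtP z y.
  by case: no_mid; exists z; split=> //; apply/dist => //; lia.
have [xw|wx|->//] := ltgtP x w.
  case: no_mid; exists w; split=> //; apply: trans1 rxy _.
  by apply/sym1/dist => //; lia.
by apply: (trans2 _ w) => //; apply/sym2/(nc2 w x y z).
Qed.

(** The relations are compared on pairs of points at increasing distance. *)
Lemma noncrossing_eq (r1 r2 : int -> int -> Prop) :
    noncrossing_equiv r1 -> noncrossing_equiv r2 ->
    (forall x, linked_left r1 x <-> linked_left r2 x) ->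
    (forall x, linked_right r1 x <-> linked_right r2 x) ->
  forall x y, r1 x y <-> r2 x y.
Proof.
move=> nc1 nc2 left12 right12.
have key k x : r1 x (x + k%:Z) <-> r2 x (x + k%:Z).
  have [n] := ubnP k; elim: n k x => // n IHn k x lt_kn.
  have IH j z : (j < k)%N -> r1 z (z + j%:Z) <-> r2 z (z + j%:Z).
    by move=> lt_jk; apply: IHn; lia.
  split; apply: noncrossing_incl => // [z|z|z j lt_jk].
  - by rewrite left12.
  - by rewrite right12.
  - exact: IH.
  - by rewrite left12.
  - by rewrite right12.
  by apply: iff_sym; apply: IH.
have [_ sym1 _ _] := nc1; have [_ sym2 _ _] := nc2.
have le x y : x <= y -> r1 x y <-> r2 x y.
  by move=> xy; have -> : y = x + `|y - x|%N%:Z by lia.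
move=> x y; case: (leP x y) => [|/ltW] /le // yx.
by split=> [/sym1/yx/sym2|/sym2/yx/sym1].
Qed.

Definition opens (r : int -> int -> Prop) (x : int) : bool := ~~ `[< linked_left r x >].
Definition continues (r : int -> int -> Prop) (x : int) : bool := `[< linked_right r x >].

(** Position 2x tells whether x opens its class, position 2x + 1 whether the class of
x continues to the right. When classes do not cross the origin, the height reached
after the two steps of each point below x is twice the number of classes that pass
over the gap before x. *)
Definition relation_word (m : nat) (r : int -> int -> Prop) : m.*2.-tuple bool :=
  [tuple if odd j then continues r j./2%:Z else opens r j./2%:Z | j < m.*2].

Lemma nth_word_even m r k : (k < m)%N ->
  nth false (relation_word m r) k.*2 = opens r k%:Z.
Proof.
move=> lt_km; have lt : (k.*2 < m.*2)%N by rewrite ltn_double.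
by rewrite -[k.*2]/(val (Ordinal lt)) -tnth_nth tnth_mktuple /= odd_double doubleK.
Qed.

Lemma nth_word_odd m r k : (k < m)%N ->
  nth false (relation_word m r) k.*2.+1 = continues r k%:Z.
Proof.
move=> lt_km; have lt : (k.*2.+1 < m.*2)%N by rewrite -doubleS leq_double.
rewrite -[k.*2.+1]/(val (Ordinal lt)) -tnth_nth tnth_mktuple /= odd_double /=.
by rewrite uphalf_double.
Qed.

Lemma word_eqP m r (t : m.*2.-tuple bool) :
    (forall k, (k < m)%N -> nth false t k.*2 = opens r k%:Z) ->
    (forall k, (k < m)%N -> nth false t k.*2.+1 = continues r k%:Z) ->
  relation_word m r = t.
Proof.
move=> te to; apply: eq_from_tnth => j; rewrite tnth_mktuple (tnth_nth false).
have lt := ltn_ord j; rewrite -[in RHS](odd_double_half j); case: ifP => oj.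
  by rewrite add1n to // -ltn_double; lia.
by rewrite add0n te // -ltn_double; lia.
Qed.

Lemma periodicM m r : periodic m r ->
  forall (k : int) x y, r (x + k * m%:Z) (y + k * m%:Z) <-> r x y.
Proof.
move=> per k; elim/int_ind: k => [|k IH|k IH] x y; first by rewrite mul0r !addr0.
  rewrite (_ : x + _ = (x + k%:Z * m%:Z) + m%:Z); last by lia.
  by rewrite (_ : y + _ = (y + k%:Z * m%:Z) + m%:Z) ?per //; lia.
rewrite -per (_ : x + _ + _ = x + - k%:Z * m%:Z); last by lia.
by rewrite (_ : y + _ + _ = y + - k%:Z * m%:Z) ?IH //; lia.
Qed.

Lemma linked_left_periodic m r : periodic m r ->
  forall (k : int) x, linked_left r (x + k * m%:Z) <-> linked_left r x.
Proof.
move=> per k x; split=> -[y yx ry].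
  exists (y - k * m%:Z); first by lia.
  by rewrite -(periodicM per k) subrK.
by exists (y + k * m%:Z); [lia | rewrite (periodicM per)].
Qed.

Lemma linked_right_periodic m r : periodic m r ->
  forall (k : int) x, linked_right r (x + k * m%:Z) <-> linked_right r x.
Proof.
move=> per k x; split=> -[y yx ry].
  exists (y - k * m%:Z); first by lia.
  by rewrite -(periodicM per k) subrK.
by exists (y + k * m%:Z); [lia | rewrite (periodicM per)].
Qed.

Lemma int_residue (m : nat) (x : int) : (0 < m)%N ->
  exists k : nat, (k < m)%N /\ exists q : int, x = k%:Z + q * m%:Z.
Proof.
move=> m_gt0; exists `|(x %% m%:Z)%Z|%N.
have m0 : m%:Z != 0 by lia.
have ge0 := modz_ge0 x m0; have lt := ltz_pmod x (_ : 0 < m%:Z).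
split; first by have := lt ltac:(lia); lia.
by exists (x %/ m%:Z)%Z; rewrite gez0_abs // addrC -divz_eq.
Qed.

Lemma relation_word_inj m r1 r2 : (0 < m)%N ->
    noncrossing_equiv r1 -> noncrossing_equiv r2 -> periodic m r1 -> periodic m r2 ->
    relation_word m r1 = relation_word m r2 ->
  forall x y, r1 x y <-> r2 x y.
Proof.
move=> m_gt0 nc1 nc2 per1 per2 e; apply: noncrossing_eq => // x;
  have [k [lt_km [q ->]]] := int_residue x m_gt0.
  rewrite (linked_left_periodic per1) (linked_left_periodic per2).
  have := nth_word_even r1 lt_km; rewrite e nth_word_even // => /negb_inj eb.
  by split=> /asboolP; [rewrite -eb | rewrite eb] => /asboolP.
rewrite (linked_right_periodic per1) (linked_right_periodic per2).
have := nth_word_odd r1 lt_km; rewrite e nth_word_odd // => eb.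
by split=> /asboolP; [rewrite -[asbool _]eb | rewrite [asbool _]eb] => /asboolP.
Qed.

Lemma relation_word_ext m r1 r2 : (forall x y, r1 x y <-> r2 x y) ->
  relation_word m r1 = relation_word m r2.
Proof.
move=> e; have -> // : r1 = r2.
by apply/funext => x; apply/funext => y; apply/propext.
Qed.

(** Reversing the line exchanges opening and closing, hence reverses the word and
negates it. *)
Lemma relation_word_mirror m r : noncrossing_equiv r -> periodic m r ->
  relation_word m (mirror r) = flip (relation_word m r) :> seq bool.
Proof.
case=> _ sym _ _ per.
have szr : size (relation_word m r) = m.*2 by rewrite size_tuple.
have sz : size (flip (relation_word m r)) == m.*2 by rewrite size_flip size_tuple.
rewrite -[RHS]/(val (Tuple sz)); congr val; apply: word_eqP => k lt_km;
  rewrite -[nth _ _ _]/(nth false (flip (relation_word m r)) _)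
    nth_flip szr; try lia.
  have -> : (m.*2 - k.*2.+1 = (m - k.+1).*2.+1)%N by lia.
  rewrite nth_word_odd; last by lia.
  congr negb; apply: asbool_equiv_eq; rewrite linked_left_mirror //.
  rewrite -(linked_right_periodic per 1 (-1 - k%:Z)).
  by rewrite [X in _ <-> linked_right r X](_ : _ = (m - k.+1)%N%:Z) //; lia.
have -> : (m.*2 - k.*2.+2 = (m - k.+1).*2)%N by lia.
rewrite nth_word_even; last by lia.
rewrite negbK; apply: asbool_equiv_eq; rewrite linked_right_mirror //.
rewrite -(linked_left_periodic per 1 (-1 - k%:Z)).
by rewrite [X in _ <-> linked_left r X](_ : _ = (m - k.+1)%N%:Z) //; lia.
Qed.

(** * The word of a periodic non-crossing equivalence *)

(** Comparison of cardinals through an injective relation, which avoids choosing the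
underlying function by hand. *)
Lemma leq_card_rel (T T' : finType) (A : {pred T}) (B : {pred T'}) (rel : T -> T' -> Prop) :
    (forall x, x \in A -> exists2 y, y \in B & rel x y) ->
    (forall x x' y, x \in A -> x' \in A -> rel x y -> rel x' y -> x = x') ->
  (#|A| <= #|B|)%N.
Proof.
move=> ex inj.
have [f fP] : exists f : T -> option T', forall x, x \in A ->
    exists2 y, f x = Some y & y \in B /\ rel x y.
  exists (fun x => [pick y in B | `[< rel x y >]]) => x xA.
  case: pickP => [y /andP[yB /asboolP]|no]; first by exists y.
  by have [y yB rxy] := ex x xA; have := no y; rewrite yB /=; move/asboolP.
rewrite -(card_in_imset (f := f) (D := A)); last first.
  move=> x x' xA xA'; have [y -> [_ rxy]] := fP x xA.
  have [y' -> [_ rxy']] := fP x' xA' => -[e]; subst y'.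
  exact: inj rxy rxy'.
have Some_inj : injective (@Some T') by move=> a b [].
rewrite -(card_imset B Some_inj); apply/subset_leq_card/subsetP => o.
by case/imsetP=> x xA ->; have [y -> [yB _]] := fP x xA; apply: imset_f.
Qed.

Definition nonopeners (r : int -> int -> Prop) k := #|[pred i : 'I_k | ~~ opens r i%:Z]|.
Definition continuers (r : int -> int -> Prop) k := #|[pred i : 'I_k | continues r i%:Z]|.

Lemma nonopenersS r k : nonopeners r k.+1 = (nonopeners r k + ~~ opens r k%:Z)%N.
Proof.
have cE j : nonopeners r j = (\sum_(i < j) ~~ opens r i%:Z)%N.
  by rewrite /nonopeners -sum1_card big_mkcond; apply: eq_bigr => i _; rewrite inE; case: opens.
by rewrite !cE big_ord_recr.
Qed.

Lemma continuersS r k : continuers r k.+1 = (continuers r k + continues r k%:Z)%N.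
Proof.
have cE j : continuers r j = (\sum_(i < j) continues r i%:Z)%N.
  by rewrite /continuers -sum1_card big_mkcond; apply: eq_bigr => i _; rewrite inE; case: continues.
by rewrite !cE big_ord_recr.
Qed.

Lemma height_relation_word m r k : (k <= m)%N ->
  height (relation_word m r) k.*2 = ((continuers r k)%:Z - (nonopeners r k)%:Z) *+ 2.
Proof.
elim: k => [|k IH] lt_km.
  by rewrite height0 /continuers /nonopeners !eq_card0 // => -[].
rewrite doubleS !heightS IH 1?ltnW // nth_word_even // nth_word_odd //.
rewrite nonopenersS continuersS /step; case: opens; case: continues => /=; lia.
Qed.

Lemma noncrossing_sym r : noncrossing_equiv r -> forall x y, r x y -> r y x.
Proof. by case. Qed.

Lemma noncrossing_trans r : noncrossing_equiv r -> forall x y z, r x y -> r y z -> r x z.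
Proof. by case. Qed.

(** Sending a point that is not least in its class to its predecessor is injective,
and the predecessor is not greatest in its class; both sides are counted modulo
the period. *)
Lemma nonopeners_le m r : (0 < m)%N -> noncrossing_equiv r -> periodic m r ->
  (nonopeners r m <= continuers r m)%N.
Proof.
move=> m_gt0 ncr per; have sym := noncrossing_sym ncr; have trans := noncrossing_trans ncr.
pose nxt (x y : int) := [/\ y < x, r y x & forall z : int, y < z -> z < x -> ~ r z x].
have nxt_inj x x' y : nxt x y -> nxt x' y -> x <= x'.
  move=> [yx ryx nx] [yx' ryx' nx']; rewrite leNgt; apply/negP => lt.
  by apply: (nx x') => //; apply: trans ryx; apply: sym.
apply: (@leq_card_rel _ _ _ _
  (fun (i j : 'I_m) => exists q : int, nxt i%:Z (j%:Z + q * m%:Z))).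
  move=> i; rewrite !inE negbK => /asboolP/nearest_left[y nxy].
  have [j [lt_jm [q e]]] := int_residue y m_gt0.
  exists (Ordinal lt_jm); last by exists q; rewrite /= -e.
  rewrite inE; apply/asboolP; rewrite -(linked_right_periodic per q) /= -e.
  by case: nxy => yi ry _; exists i%:Z.
move=> i i' j _ _ [q nq] [q' nq'].
have shift x y (k : int) : nxt x y -> nxt (x + k * m%:Z) (y + k * m%:Z).
  case=> yx ryx nx; split; [by lia|by rewrite periodicM|].
  move=> z zy zx; rewrite -[z](subrK (k * m%:Z)) periodicM //.
  by apply: nx; lia.
have := shift _ _ (q - q') nq'.
rewrite (_ : j%:Z + _ + _ = j%:Z + q * m%:Z); last by lia.
move=> nq''; apply: val_inj => /=.
have le1 := nxt_inj _ _ _ nq nq''; have le2 := nxt_inj _ _ _ nq'' nq.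
have lt := ltn_ord i; have lt' := ltn_ord i'.
have e : i%:Z = i'%:Z + (q - q') * m%:Z by apply/eqP; rewrite eq_le le1 le2.
clear -e lt lt'; move: (q - q') e => c e.
case: (ltgtP c 0) => [c_lt0|c_gt0|c0]; [nia|nia|by move: e; rewrite c0; lia].
Qed.

Lemma nonopeners_mirror m r : noncrossing_equiv r -> periodic m r ->
  nonopeners (mirror r) m = continuers r m /\ continuers (mirror r) m = nonopeners r m.
Proof.
move=> [_ sym _ _] per.
have e i : (-1 - i%:Z) + 1 * m%:Z = (m - i.+1)%N%:Z \/ (m <= i)%N.
  by case: (leqP m i) => [|lt]; [right|left]; lia.
rewrite /nonopeners /continuers -!sum1_card; split.
  rewrite [RHS](reindex_inj rev_ord_inj) /=; apply: eq_bigl => i.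
  rewrite !inE negbK; apply: asbool_equiv_eq; rewrite linked_left_mirror //.
  rewrite -(linked_right_periodic per 1 (-1 - _)).
  by case: (e i) => [->|]; [| rewrite leqNgt ltn_ord].
rewrite [RHS](reindex_inj rev_ord_inj) /=; apply: eq_bigl => i.
rewrite !inE negbK; apply: asbool_equiv_eq; rewrite linked_right_mirror //.
rewrite -(linked_left_periodic per 1 (-1 - _)).
by case: (e i) => [->|]; [| rewrite leqNgt ltn_ord].
Qed.

Lemma nonopeners_eq_continuers m r : (0 < m)%N -> noncrossing_equiv r -> periodic m r ->
  nonopeners r m = continuers r m.
Proof.
move=> m_gt0 ncr per; have [el er] := nonopeners_mirror ncr per.
apply/eqP; rewrite eqn_leq nonopeners_le //= -el -er.
by apply: nonopeners_le (mirror_noncrossing ncr) (mirror_periodic per).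
Qed.

Lemma relation_word_balanced m r : (0 < m)%N -> noncrossing_equiv r -> periodic m r ->
  word_sum (relation_word m r) = 0.
Proof.
move=> m_gt0 ncr per; rewrite /word_sum height_relation_word //.
by rewrite nonopeners_eq_continuers // subrr mul0rn.
Qed.

(** When classes do not meet two different windows, the predecessor of a point in the
window [0, m[ lies in it and before the point, so the counting of nonopeners
against continuers holds for every prefix. *)
Lemma relation_word_nonneg m r : (0 < m)%N -> noncrossing_equiv r -> periodic m r ->
    (forall x y, r x y -> (x %/ m%:Z = y %/ m%:Z)%Z) ->
  nonneg_from 0 (relation_word m r).
Proof.
move=> m_gt0 ncr per conf; have trans := noncrossing_trans ncr; have sym := noncrossing_sym ncr.
have le k : (k < m)%N -> (nonopeners r k.+1 <= continuers r k)%N.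
  move=> lt_km; pose nxt (x y : int) := [/\ y < x, r y x & forall z : int, y < z -> z < x -> ~ r z x].
  apply: (@leq_card_rel _ _ _ _ (fun (i : 'I_k.+1) (j : 'I_k) => nxt i%:Z j%:Z)).
    move=> i; rewrite !inE negbK => /asboolP/nearest_left[y nxy].
    have [yi ryi _] := nxy; have y_ge0 : 0 <= y.
      have lt_ik := ltn_ord i; have := conf _ _ ryi.
      rewrite [(i%:Z %/ _)%Z]divz_small; last by lia.
      move=> e; rewrite (divz_eq y m%:Z) e mul0r add0r modz_ge0 //; lia.
    have lt_yk : (`|y| < k)%N by have := ltn_ord i; lia.
    exists (Ordinal lt_yk) => /=; last by rewrite gez0_abs.
    by rewrite inE /= gez0_abs //; apply/asboolP; exists i%:Z.
  move=> i i' j _ _ [ji rji ni] [ji' rji' ni']; apply: val_inj => /=.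
  case: (ltngtP i i') => // lt.
    by case: (ni' i%:Z); [lia|lia|apply: trans rji'; apply: sym].
  by case: (ni i'%:Z); [lia|lia|apply: trans rji; apply: sym].
apply/nonneg_fromP => k; rewrite size_tuple add0r => le_k.
have even_ge0 j : (j <= m)%N -> 0 <= height (relation_word m r) j.*2.
  move=> le_jm; rewrite height_relation_word //; case: (ltnP j m) => [/le|le_mj].
    rewrite nonopenersS; lia.
  have -> : j = m by apply/eqP; rewrite eqn_leq le_jm.
  by rewrite nonopeners_eq_continuers // subrr mul0rn.
rewrite -(odd_double_half k); case oddk: (odd k); last by rewrite add0n; apply: even_ge0; lia.
have lt_km : (k./2 < m)%N by lia.
rewrite add1n heightS height_relation_word ?(ltnW lt_km) // nth_word_even //.
have := le _ lt_km; rewrite nonopenersS /step; case: opens => /=; lia.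
Qed.

(** * The equivalence of a balanced word *)

(** The point x sits at position 2x + 1 of the height function, between its two
steps. This inverts [relation_word]: if F is the height function of a word, then
the word of the relation is that word. *)
Definition level (F : int -> int) (x y : int) : Prop :=
  F (2 * x + 1) = F (2 * y + 1) /\
  forall j, (2 * x + 1 <= j <= 2 * y + 1) || (2 * y + 1 <= j <= 2 * x + 1) ->
    F (2 * x + 1) <= F j.

Lemma level_noncrossing F : noncrossing_equiv (level F).
Proof.
split=> [x|x y [e le]|x y z [e le] [e' le']|a b c d ab bc cd [eac leac] [ebd lebd]].
- split=> // j lej; have -> : j = 2 * x + 1 by lia.
  exact: lexx.
- by split=> // j lej; rewrite -e; apply: le; rewrite orbC.
- split; first by rewrite e.
  move=> j lej; have [|lt] := boolP ((2 * x + 1 <= j <= 2 * y + 1) || (2 * y + 1 <= j <= 2 * x + 1)).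
    exact: le.
  by rewrite e; apply: le'; lia.
have le1 := leac (2 * b + 1) ltac:(lia); have le2 := lebd (2 * c + 1) ltac:(lia).
split; first by apply/eqP; rewrite eq_le le1 eac le2.
by move=> j lej; apply: leac; lia.
Qed.

Section Level.

Variables (F : int -> int) (m : nat).
Hypothesis m_gt0 : (0 < m)%N.
Hypothesis F_step : forall j, F (j + 1) = F j + 1 \/ F (j + 1) = F j - 1.
Hypothesis F_per : forall j, F (j + (m.*2)%:Z) = F j.
Hypothesis F_parity : forall j, exists k, F j = j + 2 * k.

Lemma level_periodic : periodic m (level F).
Proof.
have shift z : F (2 * (z + m%:Z) + 1) = F (2 * z + 1).
  by rewrite -[RHS]F_per; congr F; lia.
move=> x y; rewrite /level !shift; split=> -[e le]; split=> // j lej.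
  by rewrite -[F j]F_per; apply: le; lia.
by rewrite -(subrK (m.*2)%:Z j) F_per; apply: le; lia.
Qed.

(** If the step before x goes down, follow the path to the left until it first comes
back to the height of x; this happens within one period. The position reached is
odd by parity, hence is the middle of a point. If the step goes up, the path dips
below the height of x immediately. *)
Lemma level_linked_left x : linked_left (level F) x <-> F (2 * x) = F (2 * x + 1) + 1.
Proof.
have drop (a b : int) : a <= b -> a = b + 1 \/ a = b - 1 -> b = a + 1 by lia.
have climb (a b c : int) : a < b -> b = c + 1 \/ b = c - 1 -> c <= a -> c = a by lia.
split=> [[y yx [e le]]|down].
  by apply: drop (F_step (2 * x)); rewrite -e; apply: le; lia.
pose p k := F (2 * x + 1 - k.+1%:Z) <= F (2 * x + 1).
have /ex_minnP[k pk min] : exists k, p k.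
  (* One full period to the left the height is the same. *)
  exists m.*2.-1; rewrite /p -[X in X <= _]F_per.
  by rewrite [X in F X <= _](_ : _ = 2 * x + 1) //; lia.
have above i : 2 * x + 1 - k.+1%:Z < i -> i < 2 * x + 1 -> F (2 * x + 1) < F i.
  move=> lt1 lt2; rewrite ltNge; apply/negP => le.
  have := min (absz (2 * x + 1 - i)%R).-1; rewrite /p.
  rewrite [X in F X](_ : _ = i); last by lia.
  by move/(_ le); lia.
rewrite /p in pk; move: pk above; set j := 2 * x + 1 - _ => pk above.
have lt_j : j < 2 * x.
  have : j <= 2 * x by rewrite /j; lia.
  rewrite le_eqVlt => /orP[/eqP ej|//].
  by move: pk; rewrite ej down gerDl.
have ej : F j = F (2 * x + 1).
  by apply: climb (F_step j) pk; apply: above; lia.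
have [k1 e1] := F_parity j; have [k2 e2] := F_parity (2 * x + 1).
have ejy : j = 2 * (x + k2 - k1) + 1.
  by move: ej; rewrite e1 e2; lia.
exists (x + k2 - k1); first by lia.
split; first by rewrite -ejy ej.
move=> i lei; rewrite -ejy ej; have [<-|ne1] := eqVneq j i; first by rewrite ej.
have [<-|ne2] := eqVneq (2 * x + 1) i; first exact: lexx.
by apply/ltW/above; lia.
Qed.

End Level.

Lemma mirror_level F x y : mirror (level F) x y <-> level (fun j => F (- j)) x y.
Proof.
have e (z : int) : 2 * (-1 - z) + 1 = - (2 * z + 1) by lia.
rewrite /mirror /level !e; split=> -[eF le]; split=> // j lej.
  by apply: le; lia.
by rewrite -(opprK j); apply: le; lia.
Qed.

Lemma level_linked_right F m x : (0 < m)%N ->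
    (forall j, F (j + 1) = F j + 1 \/ F (j + 1) = F j - 1) ->
    (forall j, F (j + (m.*2)%:Z) = F j) ->
    (forall j, exists k, F j = j + 2 * k) ->
  linked_right (level F) x <-> F (2 * x + 1 + 1) = F (2 * x + 1) + 1.
Proof.
move=> m_gt0 F_step F_per F_parity; pose F' j := F (- j).
have F'E : mirror (level F) = level F'.
  by apply/funext => a; apply/funext => b; apply/propext/mirror_level.
have [_ sym _ _] := level_noncrossing F.
have := linked_left_mirror (-1 - x) sym.
rewrite [X in _ <-> linked_right _ X](_ : _ = x) => [<-|]; last by lia.
rewrite F'E (level_linked_left (m := m)) // /F'.
- have eqF u v u' v' : u = u' -> v = v' -> F u = F v + 1 <-> F u' = F v' + 1.
    by move=> -> ->.
  by apply: eqF; lia.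
- move=> j; have := F_step (- (j + 1)); rewrite [- (j + 1) + 1](_ : _ = - j); last by lia.
  by case=> ->; [right | left]; rewrite ?addrK ?subrK.
- by move=> j; rewrite -[LHS]F_per; congr F; lia.
by move=> j; have [k ->] := F_parity (- j); exists (k - j); lia.
Qed.

Definition word_height m (t : m.*2.-tuple bool) (j : int) : int :=
  height t `|(j %% (m.*2)%:Z)%Z|%N.

Lemma height_parity s k : exists l : int, height s k = k%:Z + 2 * l.
Proof.
elim: k => [|k [l IH]]; first by exists 0; rewrite height0.
rewrite heightS IH; case: nth; rewrite /step; first by exists l; lia.
by exists (l - 1); lia.
Qed.

Section WordLevel.

Variables (m : nat) (t : m.*2.-tuple bool).
Hypotheses (m_gt0 : (0 < m)%N) (t0 : word_sum t = 0).
Let F := word_height t.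

Lemma word_height_nat k : (k <= m.*2)%N -> F k%:Z = height t k.
Proof.
rewrite leq_eqVlt => /orP[/eqP ->|lt_k].
  by rewrite /F /word_height modzz height0 [RHS]t0.
by rewrite /F /word_height modz_small //; lia.
Qed.

Lemma word_height_per j (k : int) : F (j + k * (m.*2)%:Z) = F j.
Proof. by rewrite /F /word_height addrC modzMDl. Qed.

Lemma word_height_step k (q : int) : (k < m.*2)%N ->
  F (k%:Z + q * (m.*2)%:Z + 1) = F (k%:Z + q * (m.*2)%:Z) + step (nth false t k).
Proof.
move=> lt_k; rewrite -addrA [_ * _ + 1]addrC addrA !word_height_per.
rewrite [X in F X = _](_ : _ = k.+1%:Z); last by lia.
by rewrite !word_height_nat ?heightS //; apply: ltnW.
Qed.

Lemma word_residue j : exists k : nat, (k < m.*2)%N /\ exists q : int,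
  j = k%:Z + q * (m.*2)%:Z.
Proof. by apply: int_residue; rewrite double_gt0. Qed.

Lemma word_height_unit j : F (j + 1) = F j + 1 \/ F (j + 1) = F j - 1.
Proof.
have [k [lt_k [q ->]]] := word_residue j; rewrite word_height_step //.
by case: nth; [left | right].
Qed.

Lemma word_height_parity j : exists k, F j = j + 2 * k.
Proof.
have [k [lt_k [q ->]]] := word_residue j; rewrite word_height_per.
rewrite word_height_nat 1?ltnW //; have [l ->] := height_parity t k.
by exists (l - q * m%:Z); lia.
Qed.

Lemma word_height_period j : F (j + (m.*2)%:Z) = F j.
Proof. by rewrite -(word_height_per j 1) mul1r. Qed.

Lemma word_level_periodic : periodic m (level F).
Proof. exact: level_periodic word_height_period. Qed.

(** Together with [relation_word_inj], this makes balanced words and periodic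
non-crossing equivalences correspond bijectively. *)
Lemma word_level_word : relation_word m (level F) = t.
Proof.
apply: word_eqP => k lt_km.
  have lt : (k.*2 < m.*2)%N by rewrite ltn_double.
  have := @word_height_step k.*2 0 lt; rewrite mul0r addr0 => st.
  rewrite /opens; have := level_linked_left m_gt0 word_height_unit word_height_period word_height_parity k%:Z.
  rewrite (_ : 2 * k%:Z = (k.*2)%:Z); last by lia.
  rewrite st /step; case: nth => eq; apply/esym.
    by apply/asboolPn => /eq; lia.
  by apply/negbTE; rewrite negbK; apply/asboolP/eq; lia.
have lt : (k.*2.+1 < m.*2)%N by lia.
have := @word_height_step k.*2.+1 0 lt; rewrite mul0r addr0 => st.
rewrite /continues; have := level_linked_right k%:Z m_gt0 word_height_unit word_height_period word_height_parity.
rewrite (_ : 2 * k%:Z + 1 = (k.*2.+1)%:Z); last by lia.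
rewrite st /step; case: nth => eq; apply/esym.
  by apply/asboolP/eq.
by apply/asboolPn => /eq; lia.
Qed.

End WordLevel.

(** * Non-crossing partitions as equivalences *)

Section NcPart.

Variables (n : nat) (n_gt1 : (1 < n)%N).
Implicit Types P : ncpart n.

Lemma intr_Zn_period (x q : int) : (x + q * n%:Z)%:~R = x%:~R :> 'Z_n.
Proof.
rewrite intrD intrM -[n%:~R]/(n%:R : 'Z_n) -[X in _ * X](_ : 0 = _) ?mulr0 ?addr0 //.
by rewrite pchar_Zp.
Qed.

Lemma intr_Zn_small (k : nat) : (k < n)%N -> nat_of_ord (k%:~R : 'Z_n) = k.
Proof.
by move=> lt; rewrite -[k%:~R]/(k%:R : 'Z_n) val_Zp_nat // modn_small.
Qed.

Lemma intr_Zn_val (x : int) :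
  exists q : int, x = (nat_of_ord (x%:~R : 'Z_n))%:Z + q * n%:Z.
Proof.
have [k [lt_kn [q ->]]] := int_residue x (ltnW n_gt1).
by exists q; rewrite intr_Zn_period intr_Zn_small.
Qed.

Lemma ltn_Zn (i : 'Z_n) : (i < n)%N.
Proof. by have := ltn_ord i; rewrite {2}Zp_cast. Qed.

Lemma intr_Zn_ord (i : 'Z_n) : (nat_of_ord i)%:Z%:~R = i.
Proof. exact: natr_Zp. Qed.

Lemma ncpart_partition P : partition (val P) [set: 'Z_n].
Proof. by case: P => P /= /andP[]. Qed.

Lemma mem_pblockP P x y :
  reflect (exists2 B, B \in val P & (x \in B) && (y \in B))
          (y \in pblock (val P) x).
Proof.
have partP := ncpart_partition P; have triv := partition_trivIset partP.
apply: (iffP idP) => [yx|[B BP /andP[xB yB]]]; last by rewrite (def_pblock triv BP).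
have xc : x \in cover (val P) by rewrite (cover_partition partP).
by exists (pblock (val P) x); rewrite ?pblock_mem // mem_pblock xc.
Qed.

(** Membership in the same block, with labels lifted to the integers. *)
Definition related P (x y : int) : bool := (y%:~R : 'Z_n) \in pblock (val P) x%:~R.

Lemma related_refl P x : related P x x.
Proof. by rewrite /related mem_pblock (cover_partition (ncpart_partition P)). Qed.

Lemma related_sym P x y : related P x y -> related P y x.
Proof.
by case/mem_pblockP=> B BP /andP[xB yB]; apply/mem_pblockP; exists B; rewrite ?yB.
Qed.

Lemma related_trans P x y z : related P x y -> related P y z -> related P x z.
Proof.
case/mem_pblockP=> B BP /andP[xB yB] /mem_pblockP[C CP /andP[yC zC]].
have triv := partition_trivIset (ncpart_partition P).
have BC : B = C by rewrite -(def_pblock triv BP yB) (def_pblock triv CP yC).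
by apply/mem_pblockP; exists B; rewrite ?xB //= BC.
Qed.

Lemma related_period P x y (p q : int) :
  related P (x + p * n%:Z) (y + q * n%:Z) = related P x y.
Proof.
by rewrite /related !intr_Zn_period.
Qed.

Lemma related_noncrossing_nat P (a b c d : nat) : (a < b)%N -> (b < c)%N -> (c < d)%N ->
  (d < n)%N -> related P a c -> related P b d -> related P a b.
Proof.
move=> ab bc cd dn /mem_pblockP[B BP /andP[aB cB]] /mem_pblockP[C CP /andP[bC dC]].
apply/mem_pblockP; exists B => //; rewrite aB /=.
have [->//|BC] := eqVneq B C.
case: P BP CP => P /= /andP[_ /forall_inP ncP] BP CP.
have /forall_inP/(_ C CP)/implyP/(_ BC)/crossingP[] := ncP B BP.
exists (a%:~R), (b%:~R), (c%:~R), (d%:~R).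
by split; split; rewrite ?intr_Zn_small //; lia.
Qed.

Lemma mem_pblock_act P (g : dihedral n) x y :
  (y \in pblock (val (ncpart_act P g)) x)
    = (vertex_act y g^-1%g \in pblock (val P) (vertex_act x g^-1%g)).
Proof.
apply/mem_pblockP/mem_pblockP => [[_ /imsetP[B BP ->] /andP[]]|[B BP /andP[xB yB]]].
  move=> /imsetP[x' xB ->] /imsetP[y' yB ->].
  exists B => //; rewrite -![vertex_act _ g^-1%g]/(vertex_action n _ _).
  by rewrite !actK xB.
exists (setact (vertex_action n) B g); first exact: imset_f.
apply/andP; split; apply/imsetP.
  by exists (vertex_action n x g^-1%g) => //; rewrite actKV.
by exists (vertex_action n y g^-1%g) => //; rewrite actKV.
Qed.

Lemma related_rotation P j x y :
  related (ncpart_act P (Dih j%:~R false)) x y = related P (x - j) (y - j).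
Proof.
rewrite /related mem_pblock_act; congr (_ \in pblock _ _);
  by rewrite dih_invE /vertex_act /= expr0 !mul1r mulN1r rmorphB.
Qed.

Lemma related_reflection P j x y :
  related (ncpart_act P (Dih j%:~R true)) x y = related P (- j - x) (- j - y).
Proof.
rewrite /related mem_pblock_act; congr (_ \in pblock _ _);
  by rewrite dih_invE /vertex_act /= expr1 !mulN1r !opprK opprD addrC rmorphB rmorphN mul1r.
Qed.

(** Cyclic form of the non-crossing condition. A rotation moves the first point to 0,
after which the four points are in increasing order of labels. *)
Lemma related_noncrossing P (a b c d : int) : a < b -> b < c -> c < d -> d < a + n%:Z ->
  related P a c -> related P b d -> related P a b.
Proof.
move=> ab bc cd da ac bd.
pose P' := ncpart_act P (Dih (- a)%:~R false).
have E (k l : nat) : related P' k l = related P (a + k%:Z) (a + l%:Z).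
  by rewrite related_rotation opprK ![_ + a]addrC.
have shift z : a <= z -> exists k : nat, z = a + k%:Z.
  by move=> az; exists (absz (z - a)); lia.
have [k1 e1] := shift b ltac:(lia); have [k2 e2] := shift c ltac:(lia).
have [k3 e3] := shift d ltac:(lia); subst b c d.
have := @related_noncrossing_nat P' 0 k1 k2 k3 ltac:(lia) ltac:(lia) ltac:(lia) ltac:(lia).
by rewrite !E addr0; apply.
Qed.

Lemma ncpart_ext P P' : (forall x y, related P x y = related P' x y) -> P = P'.
Proof.
move=> e; apply: val_inj.
rewrite -(equivalence_partition_pblock (ncpart_partition P)).
rewrite -(equivalence_partition_pblock (ncpart_partition P')).
congr equivalence_partition; apply/funext => x; apply/funext => y.
by have := e x%:Z y%:Z; rewrite /related !intr_Zn_ord.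
Qed.

Lemma ncpart_of_relation (e : int -> int -> Prop) :
    (forall x, e x x) -> (forall x y, e x y -> e y x) ->
    (forall x y z, e x y -> e y z -> e x z) ->
    (forall x y (p q : int), e (x + p * n%:Z) (y + q * n%:Z) <-> e x y) ->
    (forall a b c d, 0 <= a -> a < b -> b < c -> c < d -> d < n%:Z ->
       e a c -> e b d -> e a b) ->
  exists P, forall x y, related P x y <-> e x y.
Proof.
move=> refl sym trans per nc.
pose E (i j : 'Z_n) := `[< e i%:Z j%:Z >].
have eqE : {in [set: 'Z_n] & &, equivalence_rel E}.
  move=> i j k _ _ _; split; first by apply/asboolP.
  move=> /asboolP eij; apply/asboolP/asboolP => [eik|ejk].
    by apply: trans eik; apply: sym.
  exact: trans ejk.
have partE := equivalence_partitionP eqE.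
have ncE : noncrossing (equivalence_partition E [set: 'Z_n]).
  apply/forall_inP => B BP; apply/forall_inP => C CP; apply/implyP.
  apply: contraNN => /crossingP[a [b [c [d [[aB bC cB dC] [ab bc cd]]]]]].
  have triv := partition_trivIset partE.
  have eqB := def_pblock triv BP aB; have eqC := def_pblock triv CP bC.
  move: cB; rewrite -eqB (pblock_equivalence_partition eqE) ?inE // => /asboolP ac.
  move: dC; rewrite -eqC (pblock_equivalence_partition eqE) ?inE // => /asboolP bd.
  rewrite eq_pblock //; last by rewrite (cover_partition partE).
  rewrite (pblock_equivalence_partition eqE) ?inE //; apply/asboolP.
  apply: (nc _ _ _ _ _ _ _ _ _ ac bd); try lia.
  by have := ltn_Zn d; lia.
have prf : partition (equivalence_partition E [set: 'Z_n]) setT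
  && noncrossing (equivalence_partition E [set: 'Z_n]) by rewrite partE ncE.
exists (Sub (equivalence_partition E [set: 'Z_n]) prf) => x y.
rewrite /related SubK (pblock_equivalence_partition eqE) ?inE //.
have [p ex] := intr_Zn_val x; have [q ey] := intr_Zn_val y.
by rewrite {2}ex {2}ey per; split=> /asboolP.
Qed.

End NcPart.

(** * Counting all partitions and those fixed by a reflection *)

Lemma divz_bounds (n : nat) (x : int) : (0 < n)%N ->
  (x %/ n%:Z)%Z * n%:Z <= x < ((x %/ n%:Z)%Z + 1) * n%:Z.
Proof.
move=> n_gt0; have n0 : n%:Z != 0 by lia.
have := modz_ge0 x n0; have := ltz_pmod x (_ : 0 < n%:Z).
by move=> /(_ ltac:(lia)); have := divz_eq x n%:Z; lia.
Qed.

Lemma divz_between (n : nat) (x y z : int) : (0 < n)%N -> x <= y -> y <= z ->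
  (x %/ n%:Z = z %/ n%:Z)%Z -> (x %/ n%:Z = y %/ n%:Z)%Z.
Proof.
move=> n_gt0 xy yz e; have bx := divz_bounds x n_gt0; have bz := divz_bounds z n_gt0.
have by_ := divz_bounds y n_gt0; rewrite -e in bz.
move: (x %/ _)%Z (y %/ _)%Z bx by_ bz => p q bx by_ bz; nia.
Qed.

Lemma divz_same_dist (n : nat) (x y : int) : (0 < n)%N ->
  (x %/ n%:Z = y %/ n%:Z)%Z -> y < x + n%:Z.
Proof.
move=> n_gt0 e; have := divz_bounds x n_gt0; have := divz_bounds y n_gt0.
rewrite -e; lia.
Qed.

Section Linear.

Variables (n : nat) (n_gt1 : (1 < n)%N).
Let n_gt0 : (0 < n)%N := ltnW n_gt1.
Implicit Types P : ncpart n.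

(** The partition copied in each window of length n, with different windows kept
apart: cutting the circle between the labels n - 1 and 0. *)
Definition linear_rel P (x y : int) : Prop :=
  (x %/ n%:Z = y %/ n%:Z)%Z /\ related P x y.

Lemma linear_rel_noncrossing P : noncrossing_equiv (linear_rel P).
Proof.
split=> [x|x y [e xy]|x y z [exy xy] [eyz yz]|a b c d ab bc cd [eac ac] [ebd bd]].
- by split=> //; apply: related_refl.
- by split=> //; apply: related_sym.
- by split; [rewrite exy | apply: related_trans yz].
have eab : (a %/ n%:Z = b %/ n%:Z)%Z.
  by apply: divz_between eac => //; apply: ltW => //; apply: lt_trans bc.
split=> //; apply: (related_noncrossing n_gt1 ab bc cd) => //.
by apply: divz_same_dist => //; rewrite eab.
Qed.

Lemma linear_rel_periodic P : periodic n (linear_rel P).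
Proof.
move=> x y; have e (z : int) : ((z + n%:Z)%R %/ n%:Z)%Z = (z %/ n%:Z)%Z + 1.
  by rewrite divzDr ?dvdzz // divzz; case: n n_gt0.
rewrite /linear_rel !e; have := related_period n_gt1 P x y 1 1; rewrite !mul1r => ->.
by split=> -[exy rxy]; split=> //; lia.
Qed.

Definition dyck_word P := relation_word n (linear_rel P).

Lemma dyck_word_inj : injective dyck_word.
Proof.
move=> P P' e; apply: ncpart_ext => // x y.
have eq := relation_word_inj n_gt0 (linear_rel_noncrossing P) (linear_rel_noncrossing P')
  (@linear_rel_periodic P) (@linear_rel_periodic P') e.
have red (Q : ncpart n) : related Q x y = related Q (x %% n%:Z)%Z (y %% n%:Z)%Z.
  rewrite -(related_period n_gt1 Q (x %% n%:Z)%Z (y %% n%:Z)%Z (x %/ n%:Z)%Z (y %/ n%:Z)%Z).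
  by rewrite ![(_ %% _)%Z + _]addrC -!divz_eq.
have n0 : n%:Z != 0 by lia.
have small z : ((z %% n%:Z)%Z %/ n%:Z)%Z = 0.
  by rewrite divz_small // modz_ge0 //= ltz_mod.
rewrite !red; apply/idP/idP => rxy.
  by have [] := (eq _ _).1 (conj (etrans (small x) (esym (small y))) rxy).
by have [] := (eq _ _).2 (conj (etrans (small x) (esym (small y))) rxy).
Qed.

Lemma dyck_wordP P : nonneg_from 0 (dyck_word P) && (word_sum (dyck_word P) == 0).
Proof.
have ncP := linear_rel_noncrossing P; have perP := @linear_rel_periodic P.
rewrite relation_word_nonneg //=; last by move=> x y [].
by rewrite relation_word_balanced.
Qed.

(** The height function of a Dyck word vanishes at the ends of each window, while
points sit at odd, hence positive, heights. The classes therefore do not cross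
window boundaries, and reducing modulo n loses nothing. *)
Lemma dyck_word_surj (t : n.*2.-tuple bool) :
  nonneg_from 0 t -> word_sum t = 0 -> exists P, dyck_word P = t.
Proof.
move=> /nonneg_fromP pos t0; pose F := word_height t.
have n0 : n%:Z != 0 by lia.
have F_ge0 j : 0 <= F j.
  have [k [lt_k [q ->]]] := word_residue n_gt0 j.
  rewrite /F word_height_per word_height_nat //; last exact: ltnW.
  by have := pos k; rewrite add0r size_tuple; apply; apply: ltnW.
have F_mul q : F (2 * (q * n%:Z)) = 0.
  rewrite [2 * _](_ : _ = 0%N%:Z + q * n.*2%:Z); last by lia.
  by rewrite /F word_height_per word_height_nat // height0.
have F_odd x : 0 < F (2 * x + 1).
  have := F_ge0 (2 * x + 1); rewrite le_eqVlt => /orP[/eqP e|//].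
  by have [k] := word_height_parity n_gt0 t0 (2 * x + 1); rewrite -/F -e; lia.
have lv := level_noncrossing F; have per := word_level_periodic t n_gt0.
have conf_le x y : x <= y -> level F x y -> (x %/ n%:Z = y %/ n%:Z)%Z.
  move=> le_xy [_ le]; have bx := divz_bounds x n_gt0; have byy := divz_bounds y n_gt0.
  have [//|neq] := eqVneq (x %/ n%:Z)%Z (y %/ n%:Z)%Z.
  have lt_q : x < (y %/ n%:Z)%Z * n%:Z.
    by move: (x %/ _)%Z (y %/ _)%Z bx byy neq => p q bx byy neq; nia.
  have := le (2 * ((y %/ n%:Z)%Z * n%:Z)); rewrite F_mul.
  by move=> /(_ ltac:(lia)); rewrite leNgt F_odd.
have conf x y : level F x y -> (x %/ n%:Z = y %/ n%:Z)%Z.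
  case: (leP x y) => [|/ltW] lexy lxy; first exact: conf_le.
  by apply/esym/conf_le => //; apply: (noncrossing_sym lv).
pose e (x y : int) := level F (x %% n%:Z)%Z (y %% n%:Z)%Z.
have [|x y|x y z|x y p q|a b c d a0 ab bc cd dn|P PE] := @ncpart_of_relation n n_gt1 e.
- by move=> x; rewrite /e; case: lv => refl _ _ _; apply: refl.
- exact: (noncrossing_sym lv).
- exact: (noncrossing_trans lv).
- by rewrite /e ![_ + _ * _]addrC !modzMDl.
- by rewrite /e !modz_small; try lia; case: lv => _ _ _; apply.
exists P; rewrite -(word_level_word n_gt0 t0); apply: relation_word_ext => x y.
have eqP q : level F (x %% n%:Z)%Z (y %% n%:Z)%Z
  <-> level F (q * n%:Z + (x %% n%:Z)%Z) (q * n%:Z + (y %% n%:Z)%Z).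
  by rewrite ![q * _ + _]addrC (periodicM per).
split=> [[exy /PE]|lxy].
  by rewrite /e (eqP (x %/ n%:Z)%Z) -divz_eq exy -divz_eq.
have exy := conf _ _ lxy; split=> //; apply/PE.
by rewrite /e (eqP (x %/ n%:Z)%Z) -divz_eq exy -divz_eq.
Qed.

Lemma card_ncpart : (#|{: ncpart n}| * n.+1 = 'C(n.*2, n))%N.
Proof.
rewrite -card_dyck; congr (_ * _)%N; rewrite -(card_imset _ dyck_word_inj).
apply: eq_card => t; rewrite inE; apply/imsetP/andP => [[P _ ->]|[pos /eqP t0]].
  exact/andP/dyck_wordP.
by have [P <-] := dyck_word_surj pos t0; exists P.
Qed.

Lemma dyck_word_refl P :
  dyck_word (ncpart_act P (Dih 1 true)) = flip (dyck_word P) :> seq bool.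
Proof.
rewrite /dyck_word -(relation_word_mirror (linear_rel_noncrossing P)); last first.
  exact: linear_rel_periodic.
congr tval; apply: relation_word_ext => x y; rewrite /mirror /linear_rel.
rewrite -[1 : 'Z_n]/(1%:~R : 'Z_n) related_reflection //.
have e (z : int) : ((-1 - z)%R %/ n%:Z)%Z = -1 - (z %/ n%:Z)%Z.
  have bz := divz_bounds z n_gt0; have := divz_bounds (-1 - z)%R n_gt0.
  by move: (z %/ _)%Z ((-1 - z)%R %/ _)%Z bz => p q bz bq; nia.
by rewrite !e; split=> -[exy rxy]; split=> //; lia.
Qed.

(** The reflection that exchanges x and - 1 - x preserves the cut of the circle, so it
acts on Dyck words by reversal and negation. *)
Lemma card_fixed_refl1 :
  #|[set P : ncpart n | ncpart_act P (Dih 1 true) == P]| = 'C(n, n./2).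
Proof.
rewrite -card_dyck_flip -(card_imset _ dyck_word_inj).
apply: eq_card => t; rewrite inE; apply/imsetP/idP => [[P]|/and3P[pos /eqP t0 /eqP fl]].
  rewrite inE => /eqP fixP ->; have /andP[-> ->] /= := dyck_wordP P.
  by rewrite -dyck_word_refl fixP.
have [P eP] := dyck_word_surj pos t0; exists P => //.
rewrite inE; apply/eqP/dyck_word_inj/val_inj.
by rewrite [LHS]dyck_word_refl eP fl.
Qed.

Lemma card_fixed_conj (gT : finGroupType) (X : finType) (to : {action gT &-> X}) (g h : gT) :
  #|[set x | to x (g ^ h)%g == x]| = #|[set x | to x g == x]|.
Proof.
rewrite -[RHS](card_imset _ (act_inj to h)); apply: eq_card => x.
rewrite inE; apply/eqP/imsetP => [e|[y]].
  exists (to x h^-1%g); last by rewrite actKV.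
  rewrite inE; apply/eqP; apply: (act_inj to h); rewrite actKV -!actM.
  by rewrite -[RHS]e conjgE !mulgA.
by rewrite inE => /eqP e ->; rewrite -actM conjgE !mulgA mulgV mul1g actM e.
Qed.

(** For n odd all reflections are conjugate, because 2 is invertible modulo n. *)
Lemma card_fixed_refl (n_odd : odd n) (i : 'Z_n) :
  #|[set P : ncpart n | ncpart_act P (Dih i true) == P]| = 'C(n, n./2).
Proof.
rewrite -card_fixed_refl1.
(* Conjugating by the rotation by a turns the reflection 1 into 1 - 2a, and h is
   the inverse of 2. *)
pose h : 'Z_n := (n.+1./2)%:R; pose a := (1 - i) * h.
have h2 : h *+ 2 = 1.
  rewrite /h -mulrnA muln2 (_ : n.+1./2.*2 = n.+1) ?halfK; last first.
    by rewrite /= n_odd subn0.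
  by rewrite -natr1 pchar_Zp // add0r.
rewrite -(card_fixed_conj (ncpart_action n) (Dih 1 true) (Dih a false)).
apply: eq_card => P; rewrite !inE; congr (_ == _); congr ncpart_act.
rewrite conjgE !dih_mulE dih_invE /=; congr Dih.
rewrite expr0 expr1 !mulN1r !mul1r.
transitivity (1 - (1 - i) * (h *+ 2)); first by rewrite h2; ring.
rewrite /a; ring.
Qed.

End Linear.

(** * Counting the partitions fixed by a rotation *)

Lemma int_window (m : nat) (u v : int) : (0 < m)%N ->
  exists k : int, v < u + k * m%:Z /\ u + k * m%:Z <= v + m%:Z.
Proof.
move=> m_gt0; have [k [lt_km [q e]]] := int_residue (v - u) m_gt0.
by exists (q + 1); lia.
Qed.

Section Rotation.

Variables (n m d : nat) (m_gt0 : (0 < m)%N) (d_ge3 : (3 <= d)%N) (nE : n = (m * d)%N).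

Let n_gt1 : (1 < n)%N. Proof. by rewrite nE; nia. Qed.
Let n_gt0 : (0 < n)%N. Proof. exact: ltnW. Qed.
Let n3m : (3 * m <= n)%N. Proof. by rewrite nE; nia. Qed.

Definition rot_invariant (P : ncpart n) :=
  forall x y, related P (x + m%:Z) (y + m%:Z) = related P x y.

(** The blocks stable under the rotation: geometrically, the block that contains the
centre of the disk. *)
Definition central (P : ncpart n) x := related P x (x + m%:Z).

(** The lift of a rotation invariant partition to the universal cover of the
punctured disk. The central block lifts to a single class, and each other block
to classes of diameter less than m. *)
Definition unrolled_rel (P : ncpart n) (x y : int) : Prop :=
  related P x y /\ ((`|x - y| < m%:Z) || central P x).

Section Invariant.
Variables (P : ncpart n) (invP : rot_invariant P).
Let sym := @related_sym n P.
Let trans := @related_trans n P.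

Lemma rot_invariantM (k : int) x y :
  related P (x + k * m%:Z) (y + k * m%:Z) = related P x y.
Proof.
have per : periodic m (related P) by move=> a b; rewrite invP.
by apply/idP/idP => [/(periodicM per)|xy] //; apply/(periodicM per).
Qed.

Lemma related_central x y : related P x y -> central P x -> central P y.
Proof.
move=> xy xc; apply: trans (sym xy) _; apply: trans xc _.
by rewrite invP.
Qed.

Lemma central_shift (k : int) x : central P x -> related P x (x + k * m%:Z).
Proof.
move=> xc; elim/int_ind: k => [|k IH|k IH].
- by rewrite mul0r addr0 related_refl.
- rewrite (_ : x + _ = x + k%:Z * m%:Z + m%:Z); last by lia.
  by apply: (trans IH); apply: (related_central IH xc).
apply: (trans IH); apply: sym.
have xk : central P (x + - k.+1%:Z * m%:Z).
  rewrite /central (_ : x + _ + m%:Z = x + m%:Z + - k.+1%:Z * m%:Z); last by lia.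
  by rewrite rot_invariantM.
by move: xk; rewrite /central (_ : x + _ + m%:Z = x + - k%:Z * m%:Z) //; lia.
Qed.

(** Either y is the image of x under the rotation, or the pair x, y crosses its own
image, because both arcs between the two points are longer than m. *)
Lemma far_central x y : related P x y -> m%:Z <= y - x -> y - x < n%:Z - m%:Z ->
  central P x.
Proof.
move=> xy; rewrite le_eqVlt => /orP[/eqP e|lt1] lt2.
  by rewrite /central e [x + _]addrC subrK.
apply: (@related_noncrossing n n_gt1 P x (x + m%:Z) y (y + m%:Z)); rewrite ?invP //; lia.
Qed.

Lemma far_centralN x y : related P x y -> m%:Z <= `|x - y| ->
  `|x - y| < n%:Z - m%:Z -> central P x.
Proof.
move=> xy le1 lt2; case: (leP x y) => [lexy|ltyx]; first by apply: (far_central xy); lia.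
by apply: (related_central (sym xy)); apply: (far_central (sym xy)); lia.
Qed.

(** Two rotation invariant blocks would have interleaved points, since each of them
meets every window of length m. *)
Lemma central_unique x y : central P x -> central P y -> related P x y.
Proof.
move=> xc yc; have [k [lt1 le2]] := int_window y x m_gt0.
apply: (trans (y := y + k * m%:Z)); last exact/sym/central_shift.
move: le2; rewrite le_eqVlt => /orP[/eqP ->//|lt2].
apply: (@related_noncrossing n n_gt1 P _ _ (x + m%:Z) (y + k * m%:Z + m%:Z)) => //; try lia.
exact: (related_central (central_shift k yc)).
Qed.

(** If both classes are short, or both central, the four points fit on the circle or
the blocks coincide. If just one is central, one of its points can be shifted
by multiples of m so that all four points span less than n, and then the crossing
would make the other block central too. *)
Lemma unrolled_noncrossing : noncrossing_equiv (unrolled_rel P).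
Proof.
split=> [x|x y [xy near]|x y z [xy nxy] [yz nyz]|a b c e ab bc ce [ac nac] [be nbe]].
- by split; [exact: related_refl | rewrite subrr normr0; lia].
- split; first exact: sym.
  case/orP: near => [lt|xc]; first by apply/orP; left; rewrite distrC.
  by rewrite (related_central xy xc) orbT.
- have xz := trans xy yz; split=> //.
  have [xc|nx] := boolP (central P x); first by rewrite orbT.
  have ny : ~~ central P y by apply: contra nx => /(related_central (sym xy)).
  rewrite (negbTE nx) orbF in nxy *; rewrite (negbTE ny) orbF in nyz.
  rewrite orbF ltNge; apply: (contra _ nx) => far; apply: far_centralN xz far _; lia.
have [aC|aN] := boolP (central P a).
  have [bC|bN] := boolP (central P b).
    by split; [exact: central_unique | rewrite aC orbT].
  rewrite (negbTE bN) orbF in nbe.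
  case/negP: bN.
  (* The shift of a lies in [b - m, b[, which leaves all four points within 2m. *)
  have [k [lt1 le2]] := int_window a (b - m%:Z - 1) m_gt0.
  have a'c : related P (a + k * m%:Z) c by apply: trans ac; apply/sym/central_shift.
  have a'b : related P (a + k * m%:Z) b.
    by apply: (@related_noncrossing n n_gt1 P _ _ c e) => //; lia.
  by apply: related_central a'b _; apply: related_central (central_shift k aC) aC.
rewrite (negbTE aN) orbF in nac.
have [bC|bN] := boolP (central P b).
  (* The shift of b replaces the fourth point, and lies in ]c, c + m]. *)
  case/negP: aN; have [k [lt1 le2]] := int_window b c m_gt0.
  have bb' := central_shift k bC.
  apply: related_central (sym _) bC.
  by apply: (@related_noncrossing n n_gt1 P _ _ c (b + k * m%:Z)) => //; lia.
rewrite (negbTE bN) orbF in nbe.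
split; last by apply/orP; left; lia.
by apply: (@related_noncrossing n n_gt1 P _ _ c e) => //; lia.
Qed.

Lemma unrolled_periodic : periodic m (unrolled_rel P).
Proof.
move=> x y; rewrite /unrolled_rel /central !invP.
by rewrite (_ : x + _ - (y + _) = x - y) //; lia.
Qed.

(** Each pair of points of a block is, after moving one of them by a multiple of n,
either at distance less than m or far in both directions; in the second case the
block is central. *)
Lemma unrolledP x y : related P x y <-> exists k : int, unrolled_rel P x (y + k * n%:Z).
Proof.
have per k : related P x (y + k * n%:Z) = related P x y.
  by have := related_period n_gt1 P x y 0 k; rewrite mul0r addr0.
split=> [xy|[k []]]; last by rewrite per.
have [k [lt1 le2]] := int_window y (x - 1) n_gt0.
have [near|far] := ltP (y + k * n%:Z - x) m%:Z.
  by exists k; split; [rewrite per | apply/orP; left; lia].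
have [near|far2] := ltP (n%:Z - m%:Z) (y + k * n%:Z - x).
  by exists (k - 1); split; [rewrite per | apply/orP; left; lia].
exists k; have xk : related P x (y + k * n%:Z) by rewrite per.
split=> //; apply/orP; right; move: far2; rewrite le_eqVlt => /orP[/eqP e|lt].
  apply: sym; move: xk; rewrite -invP (_ : y + _ + m%:Z = x + 1 * n%:Z); last by lia.
  by have := related_period n_gt1 P (x + m%:Z) x 0 1; rewrite mul0r addr0 => ->.
exact: far_central xk far lt.
Qed.

End Invariant.

Definition rot_word P := relation_word m (unrolled_rel P).

Lemma rot_word_inj P P' : rot_invariant P -> rot_invariant P' ->
  rot_word P = rot_word P' -> P = P'.
Proof.
move=> invP invP' e; apply: ncpart_ext => // x y.
have eq := relation_word_inj m_gt0 (unrolled_noncrossing invP) (unrolled_noncrossing invP')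
  (unrolled_periodic invP) (unrolled_periodic invP') e.
apply/idP/idP => xy.
  by apply/(unrolledP invP'); have [k /eq] := (unrolledP invP x y).1 xy; exists k.
by apply/(unrolledP invP); have [k /eq] := (unrolledP invP' x y).1 xy; exists k.
Qed.

(** The equivalence of the word is projected to the circle. Two related points at
distance at least m sit at the minimal height of the path, since the path between
them runs through a full period; these points form the central block. Projecting
hence only identifies translates, and unrolling gives the relation back. *)
Lemma rot_word_surj (t : m.*2.-tuple bool) : word_sum t = 0 ->
  exists2 P, rot_invariant P & rot_word P = t.
Proof.
move=> t0; pose F := word_height t; have lv := level_noncrossing F.
have per := word_level_periodic t m_gt0; rewrite -/F in per.
have sym := noncrossing_sym lv; have trans := noncrossing_trans lv.
have pern (k : int) x y : level F (x + k * n%:Z) (y + k * n%:Z) <-> level F x y.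
  have kn : k * n%:Z = k * d%:Z * m%:Z by rewrite nE; lia.
  by rewrite kn; apply: periodicM per _ _ _.
have Fn (k : int) x : F (2 * (x + k * n%:Z) + 1) = F (2 * x + 1).
  have kn : 2 * (x + k * n%:Z) + 1 = 2 * x + 1 + k * d%:Z * (m.*2)%:Z by rewrite nE; lia.
  by rewrite kn /F word_height_per.
have global x y : level F x y -> m%:Z <= `|x - y| -> forall j, F (2 * x + 1) <= F j.
  move=> [_ le] far j; pose lo := if x <= y then 2 * x else 2 * y.
  (* The path between x and y has length at least one period 2m, so that every
     position has a translate on it. *)
  have [|k [lt1 le2]] := @int_window m.*2 j lo; first by rewrite double_gt0.
  rewrite -[F j](word_height_per t j k); apply: le.
  by move: lt1 le2; rewrite /lo; case: (leP x y) => xy lt1 le2; lia.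
have Fm x : F (2 * (x + m%:Z) + 1) = F (2 * x + 1).
  rewrite (_ : 2 * _ + 1 = 2 * x + 1 + 1 * (m.*2)%:Z); last by lia.
  by rewrite /F word_height_per.
pose e x y := exists k : int, level F x (y + k * n%:Z).
have esym x y : e x y -> e y x.
  case=> k xy; exists (- k); apply: sym.
  by have := (pern (- k) x (y + k * n%:Z)).2 xy; rewrite mulNr addrK.
have etrans x y z : e x y -> e y z -> e x z.
  case=> k xy [l yz]; exists (l + k); apply: trans xy _.
  by rewrite mulrDl addrA; apply/pern.
have eF x y : e x y -> F (2 * x + 1) = F (2 * y + 1).
  by case=> k [-> _]; rewrite Fn.
have sub x y z : level F x z -> (x < y < z) || (z < y < x) -> F (2 * x + 1) <= F (2 * y + 1).
  by case=> _ le yz; apply: le; lia.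
have subl x y z : level F x z -> (x < y < z) || (z < y < x) ->
    F (2 * y + 1) = F (2 * x + 1) -> level F x y.
  by case=> _ le yz eyx; split=> [|j lej]; [rewrite eyx | apply: le; lia].
have [x|//|//|x y p q|a b c f a0 ab bc cf fn ac bf|P PE] := @ncpart_of_relation n n_gt1 e.
- by exists 0; rewrite mul0r addr0; case: lv.
- split=> -[k xy].
    exists (q + k - p); move: xy.
    rewrite (_ : y + _ + _ = y + (q + k - p) * n%:Z + p * n%:Z); last by lia.
    exact: (pern p x (y + (q + k - p) * n%:Z)).1.
  exists (k + p - q); have := (pern p x (y + k * n%:Z)).2 xy.
  by rewrite (_ : y + q * _ + _ = y + k * n%:Z + p * n%:Z) //; lia.
- have [k ack] := ac; have [l bfl] := bf.
  have Fac := eF _ _ ac; have Fbf := eF _ _ bf.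
  have kpos (j : int) : 0 <= j \/ j <= -1 by lia.
  have le1 : F (2 * a + 1) <= F (2 * b + 1).
    case: (kpos k) => k0; first by apply: (sub _ _ _ ack); nia.
    by rewrite Fbf -(Fn k f); apply: (sub _ _ _ ack); nia.
  have le2 : F (2 * b + 1) <= F (2 * a + 1).
    case: (kpos l) => l0; first by rewrite Fac; apply: (sub _ _ _ bfl); nia.
    by apply: (sub _ _ _ bfl); nia.
  have eab : F (2 * b + 1) = F (2 * a + 1) by apply/eqP; rewrite eq_le le1 le2.
  case: (kpos k) => k0.
    by exists 0; rewrite mul0r addr0; apply: (subl _ _ _ ack) => //; nia.
  apply: (etrans _ f); last exact: esym.
  by exists k; apply: (subl _ _ _ ack); [nia | rewrite Fn -Fbf].
have invP : rot_invariant P.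
  have per' (k : int) x y : level F (x + m%:Z) (y + m%:Z + k * n%:Z) <-> level F x (y + k * n%:Z).
    by have := per x (y + k * n%:Z); rewrite [y + _ + m%:Z]addrAC.
  move=> x y; apply/idP/idP => /PE [k xy]; apply/PE; exists k.
    exact: (per' k x y).1.
  exact: (per' k x y).2.
exists P => //; rewrite /rot_word -(word_level_word m_gt0 t0).
apply: relation_word_ext => x y; rewrite /unrolled_rel /central.
have min_level z w : (forall j, F (2 * z + 1) <= F j) -> F (2 * z + 1) = F (2 * w + 1) ->
    level F z w by move=> le eq; split.
split=> [[/PE exy near]|xy].
  have [k xyk] := exy; case/orP: near => [near|/PE[l xml]].
    have [k0|k0] := eqVneq k 0; first by rewrite k0 mul0r addr0 in xyk.
    apply: min_level (eF _ _ exy); apply: global xyk _.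
    by case: (ltgtP k 0) k0 => // k0 _; nia.
  apply: min_level (eF _ _ exy); apply: global xml _.
  by case: (ltgtP l 0) => l0; nia.
split; first by apply/PE; exists 0; rewrite mul0r addr0.
have [//|far] := ltP; apply/PE; exists 0; rewrite mul0r addr0.
by apply: min_level; [apply: global xy far | rewrite Fm].
Qed.

Lemma card_rot_invariant : #|[set P : ncpart n | `[< rot_invariant P >]]| = 'C(m.*2, m).
Proof.
rewrite -card_balanced -(@card_in_imset _ _ rot_word); last first.
  by move=> P P'; rewrite !inE => /asboolP invP /asboolP invP'; apply: rot_word_inj.
apply: eq_card => t; rewrite inE; apply/imsetP/eqP => [[P]|t0].
  rewrite inE => /asboolP invP ->.
  exact: relation_word_balanced m_gt0 (unrolled_noncrossing invP) (unrolled_periodic invP).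
by have [P invP <-] := rot_word_surj t0; exists P => //; rewrite inE; apply/asboolP.
Qed.

End Rotation.

(** A partition is fixed by the rotation by i steps exactly when it is fixed by the
rotation by m = gcd (i, n) steps. As n is odd, the order n / m is at least 3. *)
Lemma card_fixed_rot n (n_ge3 : (3 <= n)%N) (n_odd : odd n) (i : 'Z_n) : i != 0 ->
  #|[set P : ncpart n | ncpart_act P (Dih i false) == P]|
    = 'C((gcdn i n).*2, gcdn i n).
Proof.
move=> i0; have n_gt1 : (1 < n)%N := ltnW n_ge3; have n_gt0 := ltnW n_gt1.
have i_gt0 : (0 < i)%N by rewrite lt0n.
have lt_in := ltn_Zn n_gt1 i.
set m := gcdn i n; have m_gt0 : (0 < m)%N by rewrite gcdn_gt0 i_gt0.
have mi : (m %| i)%N := dvdn_gcdl i n; have mn : (m %| n)%N := dvdn_gcdr i n.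
have nE : n = (m * (n %/ m))%N by rewrite mulnC divnK.
have d_ge3 : (3 <= n %/ m)%N.
  have odd_d : odd (n %/ m) by move: n_odd; rewrite {1}nE oddM => /andP[].
  have : (n %/ m)%N != 1%N.
    apply: contraTneq (lt_in) => d1; rewrite -leqNgt.
    have nm : n = m by rewrite [LHS]nE d1 muln1.
    by rewrite [X in (X <= _)%N]nm dvdn_leq.
  by case: (n %/ m)%N odd_d => [|[|[|]]].
rewrite -(card_rot_invariant m_gt0 d_ge3 nE).
apply: eq_card => P; rewrite !inE.
have fixE (k : int) : ncpart_act P (Dih k%:~R false) = P <->
    forall x y, related P (x + k) (y + k) = related P x y.
  split=> [e x y|e].
    by rewrite -[in LHS]e related_rotation // !addrK.
  apply: ncpart_ext => // x y; rewrite related_rotation //.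
  by rewrite -e !subrK.
have := fixE i%:Z; rewrite intr_Zn_ord => fixI.
apply/eqP/asboolP => [/fixI inv|inv].
  (* Bezout: the rotation by m is a power of the rotation by i. *)
  have [u v e _] := egcdnP n i_gt0.
  have peri : periodic i (related P) by move=> x y; rewrite inv.
  have step x : x + m%:Z = x + u%:Z * i%:Z + (- v%:Z) * n%:Z by rewrite /m; lia.
  move=> x y; rewrite !step related_period //.
  by apply/idP/idP => [/(periodicM peri)|xy] //; apply/(periodicM peri).
apply/fixI => x y; have perm : periodic m (related P) by move=> a b; rewrite inv.
have -> : i%:Z = (i %/ m)%:Z * m%:Z by rewrite -{1}(divnK mi).
by apply/idP/idP => [/(periodicM perm)|xy] //; apply/(periodicM perm).
Qed.

(** * Dihedral sieving *)

Local Close Scope complex_scope.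
Local Close Scope ring_scope.

Theorem proposition5p1 (R : realType) (n : nat) (n_ge3 : 3 <= n)
    (n_odd : odd n) :
  dihedral_sieving R (ncpart_action n) (fibcatalan n).
Proof.
apply: dihedral_sieving_fixed => -[i [|]].
  rewrite -[RHS]/(fibcatalan_value R (Dih i true)).
  by rewrite fibcatalan_value_refl // (card_fixed_refl (ltnW n_ge3) n_odd).
rewrite -[RHS]/(fibcatalan_value R (Dih i false)).
have [->|i0] := eqVneq i 0%R; last first.
  by rewrite fibcatalan_value_rot // (card_fixed_rot n_ge3 n_odd i0).
have -> : [set P | ncpart_action n P (Dih 0%R false) == P] = setT.
  by apply/setP => P; rewrite !inE -dih_oneE act1 eqxx.
apply: (mulIf (x := n.+1%:R%R)); first by rewrite pnatr_eq0.
by rewrite [RHS]mulr_natr fibcatalan_value_one -natrM cardsT card_ncpart // ltnW.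
Qed.
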